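(* Let $k\ge 2$. For every $\alpha>0$ there exists $n_0=n_0(\alpha,k)$ such that for every $n\ge n_0$ the following holds. Let $\mathbf{G}=\{G_1,\ldots,G_m\}$ be a collection of graphs on a common vertex set $V$ with $|V|=n$ such that $\delta(\mathbf{G})\ge \left(1-\frac{1}{2k}+\alpha\right)n$. Then, for every edge-colouring $\chi:E(C_n^k)\to[m]$, there exists a $\chi$-coloured $k$th power of a Hamilton cycle in $\mathbf{G}$.
   Context: Graphs are finite and simple; $[m]=\{1,\ldots,m\}$. The graphs in a collection $\mathbf{G}=\{G_1,\ldots,G_m\}$ need not be distinct (it is an indexed family), and $\delta(\mathbf{G}):=\min\{\delta(G_i): i\in[m]\}$, where $\delta(G_i)$ is the minimum degree of $G_i$. $C_n$ is the cycle on $n$ vertices, and $C_n^k$, its $k$th power, is the graph obtained from $C_n$ by adding edges between all pairs of vertices $x,y$ whose distance $d(x,y)$ in $C_n$ satisfies $2\le d(x,y)\le k$. An edge-colouring $\chi:E(H)\to[m]$ is an arbitrary function (not necessarily proper). A $\chi$-coloured copy of a graph $H$ in $\mathbf{G}$ is given by an injective map $\phi:V(H)\to V$ such that $\phi(x)\phi(y)\in E(G_{\chi(xy)})$ for every edge $xy\in E(H)$. A $\chi$-coloured $k$th power of a Hamilton cycle in $\mathbf{G}$ is a $\chi$-coloured copy of $C_n^k$ (so $\phi$ is a bijection onto $V$). *)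

(* Defs.v *)
From HB Require Import structures.
From mathcomp Require Import all_boot all_order all_algebra.
From mathcomp Require Import reals.

Set Implicit Arguments.
Unset Strict Implicit.
Unset Printing Implicit Defensive.

Record sgraph (T : finType) := SGraph {
  adj :> rel T;
  adj_sym : symmetric adj;
  adj_irr : irreflexive adj }.

(* Edges are unordered pairs {x, y} of adjacent vertices. *)
Definition edge_set (T : finType) (G : sgraph T) : {set {set T}} :=
  [set [set p.1; p.2] | p : T * T & G p.1 p.2].

Definition edge (T : finType) (G : sgraph T) : Type :=
  {e : {set T} | e \in edge_set G}.

Definition degree (T : finType) (G : sgraph T) (x : T) : nat :=
  #|[set y | G x y]|.

(* Every degree is smaller than #|T|, so the default value #|T| of the two
   minima below is only attained when T, respectively 'I_m, is empty. *)
Definition min_degree (T : finType) (G : sgraph T) : nat :=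
  \big[minn/#|T|]_(x : T) degree G x.

Definition min_degree_coll (T : finType) (m : nat) (G : 'I_m -> sgraph T) : nat :=
  \big[minn/#|T|]_(i < m) min_degree (G i).

Definition has_walk (T : finType) (G : sgraph T) (x y : T) (d : nat) : bool :=
  [exists p : d.-tuple T, path G x p && (last x p == y)].

(* Length of a shortest walk from x to y. A shortest walk has length smaller
   than #|T|; the value is #|T| when x and y are not connected. *)
Definition dist (T : finType) (G : sgraph T) (x y : T) : nat :=
  find (has_walk G x y) (iota 0 #|T|).

Lemma has_walk_sym (T : finType) (G : sgraph T) (x y : T) :
  has_walk G x y =1 has_walk G y x.
Proof.
suff H u v d : has_walk G u v d -> has_walk G v u d.
  by move=> d; apply/idP/idP; apply: H.
case/existsP=> p /andP[pth /eqP lst].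
have sz : size (rev (belast u p)) == d by rewrite size_rev size_belast size_tuple.
apply/existsP; exists (Tuple sz) => /=; apply/andP; split.
  rewrite -lst rev_path; congr is_true: pth.
  by apply: eq_path => a b; rewrite adj_sym.
case: (tval p) lst => [|a s] /= lst; first by rewrite lst.
by rewrite rev_cons last_rcons.
Qed.

Lemma dist_sym (T : finType) (G : sgraph T) (x y : T) : dist G x y = dist G y x.
Proof. by apply: eq_find; apply: has_walk_sym. Qed.

Lemma distxx (T : finType) (G : sgraph T) (x : T) : dist G x x = 0.
Proof.
rewrite /dist; have : 0 < #|T| by apply/card_gt0P; exists x.
case: #|T| => // n _ /=; suff -> : has_walk G x x 0 by [].
by apply/existsP; exists [tuple] => /=; rewrite eqxx.
Qed.

Definition power_adj (T : finType) (G : sgraph T) (k : nat) : rel T :=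
  fun x y => G x y || (2 <= dist G x y <= k).

Lemma power_adj_sym (T : finType) (G : sgraph T) (k : nat) :
  symmetric (power_adj G k).
Proof. by move=> x y; rewrite /power_adj adj_sym dist_sym. Qed.

Lemma power_adj_irr (T : finType) (G : sgraph T) (k : nat) :
  irreflexive (power_adj G k).
Proof. by move=> x; rewrite /power_adj adj_irr distxx. Qed.

Definition power_graph (T : finType) (G : sgraph T) (k : nat) : sgraph T :=
  SGraph (power_adj_sym G k) (power_adj_irr G k).

(* ordS i is the cyclic successor i + 1 mod n. The condition i != j only
   matters for n = 1; this is the cycle on n vertices for n >= 3. *)
Definition cycle_adj (n : nat) : rel 'I_n :=
  fun i j => (i != j) && ((j == ordS i) || (i == ordS j)).

Lemma cycle_adj_sym (n : nat) : symmetric (@cycle_adj n).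
Proof. by move=> i j; rewrite /cycle_adj eq_sym orbC. Qed.

Lemma cycle_adj_irr (n : nat) : irreflexive (@cycle_adj n).
Proof. by move=> i; rewrite /cycle_adj eqxx. Qed.

Definition cycle_graph (n : nat) : sgraph 'I_n :=
  SGraph (@cycle_adj_sym n) (@cycle_adj_irr n).

Definition coloured_copy (W V : finType) (H : sgraph W) (m : nat)
    (chi : edge H -> 'I_m) (G : 'I_m -> sgraph V) (phi : W -> V) : Prop :=
  injective phi /\
  forall (e : edge H) (x y : W),
    val e = [set x; y] -> G (chi e) (phi x) (phi y).

(* Main.v *)
(* Since [2 * k] vertices, with arbitrary colours, always have linearly many common
   neighbours, every vertex [v] and every position [x] to be filled have many
   "windows": blocks of [2 * k + 1] consecutive positions of the cycle, embedded so
   that the vertex at the middle position (the slot) fits at [x] and [v] fits in the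
   slot; indeed a window neighbour of the slot meets at most [k - 1] further
   constraints besides those given by the slot and by [v].  A weighting argument
   selects linearly many disjoint windows serving all pairs of an [x] and a [v], and
   these absorb any small set of positions left over.

   The other positions are covered, up to small gaps, by blocks of constant length.
   Inside a block every position has at most [k] earlier neighbours, so the bipartite
   graphs describing the extensions of a family of partial blocks by one vertex have
   minimum degree above one half; iterating perfect matchings in them yields, inside
   the set [U] of unused vertices, [#|U|] copies of the block in which each coordinate
   is uniform on [U].  For a suitable copy an exponential potential shows that all
   degrees into [U] remain proportional to [#|U|] until [U] is small. *)
Require Import Defs.
From mathcomp Require Import all_boot all_order all_algebra.
From mathcomp Require Import fingroup perm zify ring lra.
From mathcomp Require Import reals sequences exp.

Set Implicit Arguments.
Unset Strict Implicit.
Unset Printing Implicit Defensive.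
Import Order.TTheory GRing.Theory Num.Theory.

Local Open Scope nat_scope.

(** * Embeddings and perfect matchings *)

(** In the bipartite graph [B] on two copies of [U] all degrees exceed half of [#|U|]. For an
    unmatched [x] fewer than [#|U|] choices of [y] spoil a swap of the images of [x] and [y], so a
    permutation matching the most points of [U] matches all of them. *)
Lemma perfect_matching (T : finType) (U : {set T}) (B : rel T) (b : nat) :
  {in U, forall s, #|[set w in U | ~~ B s w]| <= b} ->
  {in U, forall w, #|[set s in U | ~~ B s w]| <= b} ->
  2 * b < #|U| ->
  exists s : {perm T}, s @: U = U /\ {in U, forall x, B x (s x)}.
Proof.
move=> rowB colB ltbU.
pose stab (s : {perm T}) := s @: U == U.
have stab1 : stab 1%g by apply/eqP/setP=> x; rewrite (eq_imset _ (@perm1 T)) imset_id.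
pose good (s : {perm T}) := [set x in U | B x (s x)].
(* Exchanging two images repairs a defect of a permutation. *)
case: (arg_maxnP (fun s => #|good s|) stab1) => s /eqP sU maxs.
exists s; split=> // x xU; apply: contraT => nBx.
have sP y : y \in U -> s y \in U by move=> yU; rewrite -sU imset_f.
have card_pre (Q : pred T) : #|[set y in U | Q (s y)]| = #|[set z in U | Q z]|.
  rewrite -(card_imset _ (@perm_inj _ s)); apply: eq_card => z; apply/imsetP/idP.
    by case=> y; rewrite !inE => /andP[yU Qy] ->; rewrite sP.
  rewrite inE => /andP[]; rewrite -{1}sU => /imsetP[y yU ->] Qy.
  by exists y; rewrite // inE yU.
have [y yU /andP[Bxy Byx]] : exists2 y, y \in U & B x (s y) && B y (s x).
  case: (pickP [pred y in U | B x (s y) && B y (s x)]) => [y /andP[? ?]|no].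
    by exists y.
  have : U \subset [set y in U | ~~ B x (s y)] :|: [set y in U | ~~ B y (s x)].
    by apply/subsetP=> y yU; move/(_ y): no; rewrite !inE /= yU /= -negb_and => ->.
  move/subset_leq_card; rewrite leqNgt => /negP[].
  apply: leq_ltn_trans ltbU; apply: leq_trans (leq_card_setU _ _) _.
  rewrite (card_pre (fun z => ~~ B x z)) mul2n -addnn.
  by rewrite leq_add ?rowB ?colB ?sP.
have neq_xy : y != x by apply: contraNneq nBx => e; rewrite -{2}e.
pose s' := (tperm x y * s)%g.
have s'x : s' x = s y by rewrite permM tpermL.
have s'y : s' y = s x by rewrite permM tpermR.
have s'D z : z != x -> z != y -> s' z = s z.
  by move=> zx zy; rewrite permM tpermD // eq_sym.
have stab' : stab s'.
  rewrite /stab eqEcard card_imset ?leqnn ?andbT; last exact: perm_inj.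
  apply/subsetP=> _ /imsetP[z zU ->].
  have [->|zx] := eqVneq z x; first by rewrite s'x sP.
  have [->|zy] := eqVneq z y; first by rewrite s'y sP.
  by rewrite s'D ?sP.
have := maxs _ stab'; rewrite /= leqNgt => /negP[]; apply: proper_card.
apply/properP; split; last by exists x; rewrite !inE xU ?s'x ?(negbTE nBx).
apply/subsetP=> z; rewrite !inE => /andP[zU Bz]; rewrite zU /=.
have [->|zx] := eqVneq z x; first by rewrite s'x.
have [->|zy] := eqVneq z y; first by rewrite s'y.
by rewrite s'D.
Qed.

Lemma card_nforall_le (I T : finType) (U : {set T}) (p : I -> pred T) :
  #|[set w in U | ~~ [forall i, p i w]]| <= \sum_i #|[set w in U | ~~ p i w]|.
Proof.
have -> : [set w in U | ~~ [forall i, p i w]] = \bigcup_i [set w in U | ~~ p i w].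
  apply/setP=> w; rewrite inE negb_forall; apply/andP/bigcupP.
    by case=> wU /existsP[i pi]; exists i; rewrite // inE wU.
  by case=> i _; rewrite inE => /andP[wU pi]; split=> //; apply/existsP; exists i.
elim/big_rec2: _ => [|i m A _ leA]; first by rewrite cards0.
exact: leq_trans (leq_card_setU _ _) (leq_add (leqnn _) leA).
Qed.

(** * Extending partial embeddings *)

Section Embeddings.
(* [r x y u v]: the vertex [u] at position [x] is compatible with [v] at [y]. *)
Variables (P V : finType) (nb : rel P) (r : P -> P -> rel V).
Hypothesis r_sym : forall x y u v, r x y u v = r y x v u.
Hypothesis r_free : forall x y u v, ~~ nb x y -> r x y u v.

Definition embeds (f : P -> V) (D : {set P}) : Prop :=
  {in D &, forall x y, x != y -> (f x != f y) && r x y (f x) (f y)}.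

Lemma embeds_inj f D : embeds f D -> {in D &, injective f}.
Proof.
move=> fD x y xD yD fxy; apply/eqP/contraT => /(fD _ _ xD yD).
by rewrite fxy eqxx.
Qed.

Lemma embeds_card f D : embeds f D -> #|f @: D| = #|D|.
Proof. by move/embeds_inj/card_in_imset. Qed.

Definition upd (f : P -> V) x u := fun y => if y == x then u else f y.

Lemma embeds_setU1 f D x u :
    embeds f D -> x \notin D -> u \notin f @: D ->
    {in D, forall y, nb y x -> r y x (f y) u} ->
  embeds (upd f x u) (x |: D).
Proof.
move=> fD xD uD rx y z; rewrite !inE /upd.
have key w : w \in D -> (u != f w) && r w x (f w) u.
  move=> wD; apply/andP; split; first by apply: contraNneq uD => ->; apply: imset_f.
  by case: (boolP (nb w x)) => [/rx|/r_free]; apply.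
have [->|yx] := eqVneq y x; have [->|zx] := eqVneq z x; rewrite ?eqxx //=.
- by move=> _ /key; rewrite (r_sym x).
- by move=> /key; rewrite eq_sym.
- exact: fD.
Qed.

Lemma embeds_block f D (q : nat -> P) (g : nat -> V) l :
    embeds f D ->
    (forall i j, i < j < l -> q i != q j) ->
    (forall i, i < l -> q i \notin D /\ {in D, forall y, ~~ nb y (q i)}) ->
    (forall i, i < l -> g i \notin f @: D) ->
    (forall i j, i < j < l -> (g i != g j) && r (q i) (q j) (g i) (g j)) ->
  exists f', [/\ {in D, f' =1 f}, forall i, i < l -> f' (q i) = g i &
    embeds f' (D :|: [set q i | i : 'I_l])].
Proof.
move=> fD; elim: l => [|l IH] qI qD gD gI.
  exists f; split=> // x y; rewrite !inE.
  have no w : (w \in [set q i | i : 'I_0]) = false by apply/imsetP=> -[[]].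
  by rewrite !no !orbF; apply: fD.
case: IH => [i j ij|i ij|i ij|i j ij|f' [f'D f'q emb']];
  [by apply: qI; lia|by apply: qD; lia|by apply: gD; lia|by apply: gI; lia|].
have qln : q l \notin D :|: [set q i | i : 'I_l].
  rewrite inE negb_or; case: (qD l) => // -> _ /=.
  by apply/imsetP=> -[i _ /eqP]; apply/negP; rewrite eq_sym qI ?ltn_ord ?leqnn.
exists (upd f' (q l) (g l)); split.
- move=> x xD; rewrite /upd; case: eqP => [xl|_]; last exact: f'D.
  by case: (qD l) => //; rewrite -xl xD.
- move=> i; rewrite ltnS leq_eqVlt => /orP[/eqP->|il]; first by rewrite /upd eqxx.
  by rewrite /upd (negPf (qI i l _)) ?f'q //; lia.
have -> : D :|: [set q i | i : 'I_l.+1] = q l |: (D :|: [set q i | i : 'I_l]).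
  rewrite setUCA; congr (_ :|: _); apply/setP=> x; rewrite !inE; apply/imsetP/orP.
    case=> i _ ->; have := ltn_ord i; rewrite ltnS leq_eqVlt => /orP[/eqP->|il].
      by left.
    by right; apply/imsetP; exists (Ordinal il).
  case=> [/eqP->|/imsetP[i _ ->]]; first by exists ord_max.
  by exists (widen_ord (leqnSn l) i).
apply: embeds_setU1 => //.
- apply/imsetP=> -[x]; rewrite inE => /orP[xD|/imsetP[i _ ->]].
    rewrite f'D // => gl; case/negP: (gD l (ltnSn _)).
    by rewrite gl imset_f.
  rewrite f'q ?ltn_ord // => gl; have := gI i l.
  by rewrite ltn_ord leqnn gl eqxx => /(_ isT).
- move=> x; rewrite inE => /orP[xD|/imsetP[i _ ->] _].
    by case: (qD l (ltnSn _)) => _ /(_ x xD) /negPf ->.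
  rewrite f'q ?ltn_ord //; have := gI i l.
  by rewrite ltn_ord leqnn => /(_ isT) /andP[].
Qed.

Variable d : nat.
Hypothesis r_deg : forall x y u, #|[set v | ~~ r x y u v]| <= d.

(** A triple [(y, x, v)] encodes the constraint that [v] at [y] imposes on the vertex at [x]; each
    one excludes at most [d] vertices. *)
Lemma card_avail (cs : seq (P * P * V)) (F : {set V}) :
  #|V| <= #|[set u | (u \notin F) && all (fun c => r c.1.1 c.1.2 c.2 u) cs]|
          + (size cs * d + #|F|).
Proof.
elim: cs => [|c cs IH] /=.
  have -> : [set u | (u \notin F) && true] = ~: F by apply/setP=> u; rewrite !inE andbT.
  by rewrite add0n addnC cardsC.
apply: (leq_trans IH); rewrite mulSn !addnA leq_add2r leq_add2r.
apply: (leq_trans _ (leq_add (leqnn _) (r_deg c.1.1 c.1.2 c.2))).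
apply: leq_trans (leq_card_setU _ _); apply/subset_leq_card/subsetP=> u.
by rewrite !inE => /andP[-> ->]; rewrite andbT; case: (r _ _ _ _).
Qed.

Variable k2 : nat.
Hypothesis nb_sym : symmetric nb.
Hypothesis nb_deg : forall x, #|[set y | nb x y]| <= k2.

Lemma nb_constraints (f : P -> V) (D : {set P}) x :
  exists2 cs : seq (P * P * V), size cs <= k2 &
    forall u, all (fun c => r c.1.1 c.1.2 c.2 u) cs ->
      {in D, forall y, nb y x -> r y x (f y) u}.
Proof.
exists [seq (y, x, f y) | y <- enum [set y in D | nb x y]].
  rewrite size_map -cardE; apply: leq_trans (nb_deg x).
  by apply/subset_leq_card/subsetP=> y; rewrite !inE => /andP[].
move=> u /allP H y yD yx; apply: (H (y, x, f y)).
by apply: map_f; rewrite mem_enum inE yD nb_sym.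
Qed.

Lemma embeds_greedy f D F :
    embeds f D -> k2 * d + #|D :|: F| <= #|V| ->
  exists2 g, {in D, g =1 f} & embeds g (D :|: F).
Proof.
move: {2}(#|F :\: D|) (leqnn #|F :\: D|) => m.
elim: m f D => [|m IH] f D ltm fD le_n.
  exists f => //; suff -> : D :|: F = D by [].
  apply/setUidPl; rewrite -setD_eq0 -cards_eq0; lia.
have [FD|] := boolP (F \subset D); first by exists f; rewrite ?(setUidPl FD).
case/subsetPn=> x xF xD.
have [cs le_cs csP] := nb_constraints f D x.
have ltD : #|D| < #|D :|: F|.
  by apply/proper_card/properP; split; [apply: subsetUl|exists x; rewrite ?inE ?xF ?orbT].
have [u] : exists u, u \in
    [set u | (u \notin f @: D) && all (fun c => r c.1.1 c.1.2 c.2 u) cs].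
  apply/set0Pn; rewrite -card_gt0; have := card_avail cs (f @: D).
  rewrite (embeds_card fD); have := leq_mul le_cs (leqnn d); lia.
rewrite inE => /andP[uD /csP ux].
have emb' := embeds_setU1 fD xD uD ux.
have eqU : (x |: D) :|: F = D :|: F.
  by rewrite -setUA; apply/setUidPr; rewrite sub1set inE xF orbT.
case: (IH _ _ _ emb'); rewrite ?eqU //.
  move: ltm; rewrite (cardsD1 x (F :\: D)) !inE xF xD add1n ltnS.
  apply: leq_trans; apply/subset_leq_card/subsetP=> y.
  by rewrite !inE negb_or => /andP[/andP[-> ->] ->].
move=> g gD emb; exists g => // y yD.
by rewrite gD ?inE ?yD ?orbT // /upd; case: eqP yD xD => // -> ->.
Qed.


(* For [x] in [U] the block [i |-> s i x] is valid, and each of its coordinates is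
   uniform when [x] is. *)
Lemma uniform_blocks (U : {set V}) (M k K : nat) (q : nat -> P) :
    (forall x y v, #|[set w in U | ~~ r x y v w]| <= M) ->
    (forall i, i < K -> #|[set j : 'I_i | nb (q j) (q i)]| <= k) ->
    2 * (k * M + K) < #|U| ->
  exists s : nat -> {perm V},
    (forall i, i < K -> s i @: U = U) /\
    forall i j, i < j < K ->
      {in U, forall x, (s i x != s j x) && r (q i) (q j) (s i x) (s j x)}.
Proof.
move=> UM; elim: K => [|K IH] qk ltU.
  by exists (fun=> 1%g); split=> // i j /andP[].
case: IH => [i iK||s [sU sB]]; [by apply: qk; lia|by lia|].
pose B x w := [forall i : 'I_K, (s i x != w) && r (q i) (q K) (s i x) w].
(* Each earlier coordinate forbids one vertex for injectivity, and up to [M] more only if its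
   position is one of the at most [k] related by [nb]. *)
have sum_le (F : 'I_K -> nat) :
    (forall i, F i <= 1 + (if nb (q i) (q K) then M else 0)) -> \sum_i F i <= k * M + K.
  move=> FM; apply: (@leq_trans (\sum_(i < K) (1 + if nb (q i) (q K) then M else 0))).
    by apply: leq_sum.
  rewrite big_split /= -big_mkcond sum1_card card_ord /= sum_nat_const addnC leq_add2r.
  rewrite leq_mul2r; apply/orP; right; have := qk K (ltnSn K).
  by congr (_ <= _); apply: eq_card => j; rewrite !inE.
have [|||t [tU tB]] := @perfect_matching V U B (k * M + K).
- move=> x xU; apply: leq_trans (card_nforall_le _ _) _; apply: sum_le => i.
  have -> : [set w in U | ~~ ((s i x != w) && r (q i) (q K) (s i x) w)] =
      [set w in U | s i x == w] :|: [set w in U | ~~ r (q i) (q K) (s i x) w].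
    by apply/setP=> w; rewrite !inE negb_and negbK andb_orr.
  apply: leq_trans (leq_card_setU _ _) (leq_add _ _).
    rewrite -(cards1 (s i x)); apply/subset_leq_card/subsetP=> w.
    by rewrite !inE => /andP[_]; rewrite eq_sym.
  case: ifPn => [_|/r_free nf]; first exact: UM.
  by rewrite leqn0 cards_eq0; apply/eqP/setP=> w; rewrite !inE nf andbF.
- move=> w wU; apply: leq_trans (card_nforall_le _ _) _; apply: sum_le => i.
  have -> : [set x in U | ~~ ((s i x != w) && r (q i) (q K) (s i x) w)] =
      [set x in U | s i x == w] :|: [set x in U | ~~ r (q i) (q K) (s i x) w].
    by apply/setP=> x; rewrite !inE negb_and negbK andb_orr.
  apply: leq_trans (leq_card_setU _ _) (leq_add _ _).
    rewrite -(cards1 ((s i)^-1%g w)); apply/subset_leq_card/subsetP=> x.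
    by rewrite !inE => /andP[_ /eqP<-]; rewrite permK.
  case: ifPn => [_|/r_free nf].
    (* Since [s i] permutes [U], it maps the excluded [x] injectively to vertices of [U]
       incompatible with [w]. *)
    apply: leq_trans (UM (q K) (q i) w).
    rewrite -(card_imset _ (@perm_inj _ (s i))); apply/subset_leq_card/subsetP.
    move=> _ /imsetP[x + ->]; rewrite !inE (r_sym (q K)) => /andP[xU ->].
    by rewrite andbT -(sU i) ?ltn_ord // imset_f.
  by rewrite leqn0 cards_eq0; apply/eqP/setP=> x; rewrite !inE nf andbF.
- by lia.
exists (fun i => if i == K then t else s i); split.
  by move=> i; case: eqP => // iK iK1; apply: sU; lia.
move=> i j /andP[ij jK] x xU; have -> : (i == K) = false by lia.
have [jK'|jK'] := eqVneq j K; last by apply: (sB i j _ x xU); lia.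
have iK : i < K by lia.
by rewrite jK'; have /forallP/(_ (Ordinal iK)) := tB x xU.
Qed.

End Embeddings.

(** * The degree potential *)

Local Open Scope ring_scope.

(** [expR z] is at most [1 / (1 - z)], and the right-hand side times [1 - z] equals
    [1 + z ^+ 2 * (1 - 2 * z)], which is at least 1. *)
Lemma expR_le_quad (R : realType) (z : R) :
  `|z| <= 1 / 2 -> expR z <= 1 + z + 2 * z ^+ 2.
Proof.
rewrite ler_norml => /andP[z1 z2].
have lt0 : 0 < 1 - z by lra.
have : expR z <= (1 - z)^-1.
  rewrite -[z in expR z]opprK expRN lef_pV2 ?posrE ?expR_gt0 //.
  exact: expR_ge1Dx.
move/le_trans; apply; rewrite -div1r ler_pdivrMr // -subr_ge0.
have -> : (1 + z + 2 * z ^+ 2) * (1 - z) - 1 = z ^+ 2 * (1 - 2 * z) by ring.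
by rewrite mulr_ge0 ?sqr_ge0 //; lra.
Qed.

Lemma sum_le0_exists (R : realType) (T : finType) (U : {set T}) (F : T -> R) :
  (0 < #|U|)%N -> \sum_(x in U) F x <= 0 -> exists2 x, x \in U & F x <= 0.
Proof.
case/card_gt0P=> x0 x0U sum_le0.
have [x /andP[xU Fx]|no] := pickP [pred x | (x \in U) && (F x <= 0)]; first by exists x.
have pos x : x \in U -> 0 < F x.
  by move=> xU; rewrite ltNge; move: (no x); rewrite /= xU /= => ->.
move: sum_le0; rewrite (bigD1 x0) //= leNgt => /negP[].
by rewrite ltr_wpDr ?pos // sumr_ge0 // => x /andP[/pos/ltW].
Qed.

Section Potential.
Variables (R : realType) (P V : finType) (nb : rel P) (r : P -> P -> rel V).
Hypothesis r_sym : forall x y u v, r x y u v = r y x v u.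
Hypothesis r_free : forall x y u v, ~~ nb x y -> r x y u v.

Definition nonnb (U : {set V}) (c : P * P * V) : {set V} :=
  [set w in U | ~~ r c.1.1 c.1.2 c.2 w].

(* Removing from [U] a block whose coordinates are each uniform on [U] leaves the
   expected ratio [#|nonnb U c| / #|U|] unchanged, so the exponential potential
   only grows by a second order term. *)
Definition potential (lam : R) (U : {set V}) : R :=
  \sum_(c : P * P * V) expR (lam * #|nonnb U c|%:R / #|U|%:R).

(** For [x] uniform in [U], removing the block [i |-> s i x] changes each exponent by an amount of
    mean zero and absolute value at most [zeta]. The quadratic bound on [expR] controls the average
    of the new potential, and some [x] does no worse than the average. *)
Lemma potential_step (U : {set V}) (M k K : nat) (q : nat -> P) (lam zeta : R) :
    (forall c, #|nonnb U c| <= M)%N ->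
    (forall i, i < K -> #|[set j : 'I_i | nb (q j) (q i)]| <= k)%N ->
    (2 * (k * M + K) < #|U|)%N ->
    0 <= lam -> lam * K%:R <= zeta * (#|U| - K)%:R -> zeta <= 1 / 2 ->
  exists g : nat -> V,
    [/\ forall i, (i < K)%N -> g i \in U,
        forall i j, (i < j < K)%N -> (g i != g j) && r (q i) (q j) (g i) (g j) &
        potential lam (U :\: [set g i | i : 'I_K]) <=
          potential lam U * (1 + 2 * zeta ^+ 2)].
Proof.
move=> UM qk ltU lam0 lamK zeta2.
have [|s [sU sB]] := uniform_blocks r_sym r_free _ qk ltU.
  by move=> x y v; apply: (UM (x, y, v)).
have sin i x : (i < K)%N -> x \in U -> s i x \in U.
  by move=> iK xU; rewrite -(sU i iK) imset_f.
pose A x := [set s i x | i : 'I_K].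
have s_inj x : x \in U -> injective (fun i : 'I_K => s i x).
  move=> xU.
  have neq (i j : 'I_K) : (i < j)%N -> s i x != s j x.
    by move=> ij; have := sB i j _ x xU; rewrite ij ltn_ord => /(_ isT) /andP[].
  move=> i j eqs; apply: ord_inj.
  by case: (ltngtP (i : nat) j) => [/neq|/neq|//]; rewrite eqs eqxx.
have cardA x : x \in U -> #|A x| = K.
  by move=> xU; rewrite card_imset ?card_ord //; apply: s_inj.
have AU x : x \in U -> A x \subset U.
  by move=> xU; apply/subsetP=> _ /imsetP[i _ ->]; apply: sin.
have K_u : (K < #|U|)%N by lia.
set u := #|U|%:R : R; set u' := (#|U| - K)%:R : R.
have u'E : u' = u - K%:R by rewrite /u' natrB // ltnW.
have u'0 : 0 < u' by rewrite ltr0n subn_gt0.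
have u0 : 0 < u by rewrite ltr0n; lia.
have cardD x : x \in U -> #|U :\: A x| = (#|U| - K)%N.
  by move=> xU; rewrite cardsD (setIidPr (AU x xU)) cardA.
pose n c x := (\sum_(i < K) ~~ r c.1.1 c.1.2 c.2 (s i x))%N.
have nE c x : x \in U -> n c x = #|nonnb U c :&: A x|.
  move=> xU; have -> : nonnb U c :&: A x = [set w in A x | ~~ r c.1.1 c.1.2 c.2 w].
    apply/setP=> w; rewrite !inE andbC; case wA: (w \in A x) => //=.
    by rewrite (subsetP (AU x xU)).
  rewrite -sum1dep_card big_mkcondr /= big_imset /=; last by move=> i j _ _; apply: s_inj.
  by rewrite /n; apply: eq_bigr => i _; case: (r _ _ _ _).
have nonnbD c x : x \in U -> (#|nonnb (U :\: A x) c| = #|nonnb U c| - n c x)%N.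
  move=> xU; have -> : nonnb (U :\: A x) c = nonnb U c :\: A x.
    by apply/setP=> w; rewrite !inE andbA.
  by rewrite cardsD nE.
pose X c : R := #|nonnb U c|%:R.
(* The change of the exponent of [c] when the block of [x] leaves [U]: [u] drops by [K] and [X c] by
   [n c x]. *)
pose z c x := lam * (K%:R * X c / u - (n c x)%:R) / u'.
have n_le c x : (n c x <= K)%N.
  rewrite /n -[X in (_ <= X)%N]card_ord -sum1_card; apply: leq_sum => i _.
  by case: (r _ _ _ _).
have X_le c : X c <= u.
  by rewrite ler_nat; apply/subset_leq_card/subsetP=> w; rewrite inE => /andP[].
have X_ge0 c : 0 <= X c by rewrite ler0n.
have z_le c x : `|z c x| <= zeta.
  have u'V : 0 < u'^-1 by rewrite invr_gt0.
  rewrite /z !normrM (ger0_norm lam0) (gtr0_norm u'V) ler_pdivrMr //.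
  apply: le_trans lamK; apply: ler_wpM2l => //.
  have XK : K%:R * X c / u <= K%:R.
    by rewrite ler_pdivrMr // ler_wpM2l // ler0n.
  have XK0 : 0 <= K%:R * X c / u by rewrite !mulr_ge0 ?ler0n // invr_ge0 ltW.
  have nK : (n c x)%:R <= K%:R :> R by rewrite ler_nat.
  have n0 : 0 <= (n c x)%:R :> R by rewrite ler0n.
  by rewrite ler_norml; lra.
(* Each [s i] permutes [U], so each of the [K] coordinates hits every vertex of [nonnb U c] exactly
   once. *)
have sum_n c : \sum_(x in U) (n c x)%:R = K%:R * X c :> R.
  rewrite -natr_sum /n exchange_big /= /X -natrM; congr _%:R.
  rewrite -[X in (X * _)%N]card_ord -sum_nat_const; apply: eq_bigr => i _.
  rewrite /nonnb -sum1dep_card -{2}(sU i (ltn_ord i)).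
  rewrite big_mkcondr /= big_imset /=; last by move=> a b _ _; apply: perm_inj.
  by apply: eq_bigr => x _; case: (r _ _ _ _).
have sum_z c : \sum_(x in U) z c x = 0.
  rewrite /z -mulr_suml -mulr_sumr big_split /= sumrN sum_n sumr_const -[_ *+ #|_|]mulr_natr.
  by rewrite -/u divfK ?gt_eqF // subrr mulr0 mul0r.
pose E c := expR (lam * X c / u).
have step c x : x \in U ->
    expR (lam * #|nonnb (U :\: A x) c|%:R / #|U :\: A x|%:R) <=
    E c * (1 + 2 * zeta ^+ 2) + E c * z c x.
  move=> xU; have Xn : #|nonnb (U :\: A x) c|%:R = X c - (n c x)%:R.
    by rewrite nonnbD // natrB // nE // subset_leq_card ?subsetIl.
  have -> : lam * #|nonnb (U :\: A x) c|%:R / #|U :\: A x|%:R = lam * X c / u + z c x.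
    rewrite Xn cardD // -/u' /z; rewrite u'E; field.
    by rewrite -u'E !gt_eqF.
  rewrite expRD -mulrDr ler_wpM2l ?expR_ge0 //.
  apply: le_trans (expR_le_quad (le_trans (z_le c x) zeta2)) _.
  rewrite addrAC lerD2r lerD2l ler_wpM2l // -real_normK ?num_real //.
  rewrite lerXn2r ?nnegrE ?normr_ge0 //; exact: le_trans (z_le c x).
pose F x := potential lam (U :\: A x) - potential lam U * (1 + 2 * zeta ^+ 2).
have [||x xU Fx] := @sum_le0_exists R V U F; first by lia.
- apply: (@le_trans _ _ (\sum_(x in U) \sum_c E c * z c x)).
    apply: ler_sum => x xU; rewrite /F /potential mulr_suml -sumrB.
    by apply: ler_sum => c _; rewrite lerBlDl; apply: step.
  rewrite exchange_big /= big1 // => c _.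
  by rewrite -mulr_sumr sum_z mulr0.
exists (fun i => s i x); split.
- by move=> i iK; apply: sin.
- by move=> i j ij; apply: sB.
- by rewrite -subr_le0.
Qed.


Definition block_set (bq : nat -> nat -> P) (K S : nat) : {set P} :=
  \bigcup_(b < S) [set bq b i | i : 'I_K].

Lemma block_setP (bq : nat -> nat -> P) (K S : nat) (x : P) :
  reflect (exists b i, [/\ (b < S)%N, (i < K)%N & x = bq b i]) (x \in block_set bq K S).
Proof.
apply: (iffP bigcupP) => [[b _ /imsetP[i _ ->]]|[b [i [bS iK ->]]]].
  by exists b, i.
by exists (Ordinal bS) => //; apply/imsetP; exists (Ordinal iK).
Qed.

(** The blocks are added one by one. The last premise speaks of arbitrary [X] because a single term
    of the potential already bounds every [#|nonnb U c|], and this bound is what the next block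
    needs. *)
Lemma embeds_blocks (f0 : P -> V) (D0 : {set P}) (bq : nat -> nat -> P)
    (k K S : nat) (lam zeta : R) :
    embeds r f0 D0 ->
    (forall b i j, (b < S)%N -> (i < j < K)%N -> bq b i != bq b j) ->
    (forall b i, (b < S)%N -> (i < K)%N ->
       bq b i \notin D0 /\ {in D0, forall y, ~~ nb y (bq b i)}) ->
    (forall b b' i i', (b' < b < S)%N -> (i < K)%N -> (i' < K)%N ->
       bq b' i' != bq b i /\ ~~ nb (bq b' i') (bq b i)) ->
    (forall b i, (b < S)%N -> (i < K)%N ->
       #|[set j : 'I_i | nb (bq b j) (bq b i)]| <= k)%N ->
    0 <= lam -> zeta <= 1 / 2 ->
    (forall b u, (b < S)%N -> (u + #|D0| + b * K = #|V|)%N ->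
       [/\ (2 * K < u)%N, lam * K%:R <= zeta * (u - K)%:R &
           forall X : nat, expR (lam * X%:R / u%:R) <=
             potential lam (~: f0 @: D0) * (1 + 2 * zeta ^+ 2) ^+ b ->
             (2 * (k * X + K) < u)%N]) ->
  exists f, [/\ {in D0, f =1 f0}, embeds r f (D0 :|: block_set bq K S) &
    #|D0 :|: block_set bq K S| = (#|D0| + S * K)%N].
Proof.
move=> f0D bqI bqD bqB bqk lam0 zeta2 num.
suff: forall b, (b <= S)%N -> exists f, [/\ {in D0, f =1 f0},
    embeds r f (D0 :|: block_set bq K b),
    (#|D0 :|: block_set bq K b| = #|D0| + b * K)%N &
    potential lam (~: f @: (D0 :|: block_set bq K b)) <=
      potential lam (~: f0 @: D0) * (1 + 2 * zeta ^+ 2) ^+ b].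
  by move=> /(_ S (leqnn S)) [f [fD fE fS _]]; exists f.
elim=> [_|b IH bS].
  by exists f0; rewrite /block_set big_ord0 setU0 expr0 mulr1 mul0n addn0.
have [f [fD fE cardD pot]] := IH (ltnW bS).
set Dm := D0 :|: block_set bq K b in fE cardD pot *.
pose U := ~: f @: Dm.
have cardU : (#|U| + #|D0| + b * K = #|V|)%N.
  by rewrite -addnA -cardD -(embeds_card fE) addnC cardsC.
have [K_u lamK X_u] := num b _ bS cardU.
have [|||g [gU gB potg]] := @potential_step U (\max_c #|nonnb U c|) k K (bq b) lam zeta
  _ _ _ lam0 lamK zeta2.
- by move=> c; apply: leq_bigmax.
- by move=> i iK; apply: bqk.
- elim/big_ind: _ => [|m1 m2 h1 h2|c _]; first by rewrite muln0.
    by rewrite /maxn; case: ifP.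
  apply: X_u; apply: le_trans pot; rewrite /potential (bigD1 c) //= -/U.
  by rewrite lerDl sumr_ge0 // => c' _; apply: expR_ge0.
have Dm_notin i : (i < K)%N -> bq b i \notin Dm /\ {in Dm, forall y, ~~ nb y (bq b i)}.
  move=> iK; have [nD0 nbD0] := bqD b i bS iK; split.
    rewrite inE negb_or nD0; apply/block_setP=> -[b' [i' [b'b i'K /eqP]]].
    by apply/negP; rewrite eq_sym; case: (bqB b b' i i') => //; rewrite b'b.
  move=> y; rewrite inE => /orP[/nbD0 //|/block_setP[b' [i' [b'b i'K ->]]]].
  by case: (bqB b b' i i') => //; rewrite b'b.
have [||f' [f'f f'g emb']] := embeds_block r_sym r_free fE _ Dm_notin _ gB.
- by move=> i j; apply: bqI.
- by move=> i /gU; rewrite inE.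
have DmS : D0 :|: block_set bq K b.+1 = Dm :|: [set bq b i | i : 'I_K].
  by rewrite /block_set big_ord_recr /= setUA.
have im' : f' @: (Dm :|: [set bq b i | i : 'I_K]) = f @: Dm :|: [set g i | i : 'I_K].
  rewrite imsetU (eq_in_imset f'f) -imset_comp; congr (_ :|: _).
  by apply: eq_imset => i /=; apply: f'g.
exists f'; rewrite DmS; split=> //.
- by move=> x xD; rewrite f'f ?fD // inE xD.
- rewrite -(embeds_card emb') im' cardsU (embeds_card fE) cardD.
  have -> : f @: Dm :&: [set g i | i : 'I_K] = set0.
    apply/setP=> w; rewrite !inE andbC; apply/negP=> /andP[/imsetP[i _ ->]].
    by have := gU i (ltn_ord i); rewrite inE => /negP.
  rewrite cards0 subn0 card_imset ?card_ord; first by lia.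
  have neq (i j : 'I_K) : (i < j)%N -> g i != g j.
    by move=> ij; have := gB i j; rewrite ij ltn_ord => /(_ isT) /andP[].
  move=> i j eqs; apply: ord_inj.
  by case: (ltngtP (i : nat) j) => [/neq|/neq|//]; rewrite eqs eqxx.
- rewrite im' setCU -setDE; apply: (le_trans potg).
  by rewrite [_ ^+ b.+1]exprSr mulrA ler_wpM2r // addr_ge0 // mulr_ge0 // sqr_ge0.
Qed.

End Potential.

(** * Absorption *)

Local Open Scope nat_scope.

(** * Counting sequences built vertex by vertex *)

Section Counting.
Variables (V : finType) (ok : seq V -> pred V).

Fixpoint chain (pre s : seq V) : bool :=
  if s is x :: s' then ok pre x && chain (rcons pre x) s' else true.

Lemma chain_nth x0 pre s i :
  chain pre s -> i < size s -> ok (pre ++ take i s) (nth x0 s i).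
Proof.
elim: s pre i => [|x s IH] pre [|i] //= /andP[okx cs].
  by rewrite cats0.
by move=> ltis; rewrite -cat_rcons; apply: IH.
Qed.

Lemma card_chain (a l : nat) pre :
  (forall s, size s < size pre + l -> a <= #|[set x | ok s x]|) ->
  a ^ l <= #|[set t : l.-tuple V | chain pre t]|.
Proof.
elim: l pre => [|l IH] pre le_a.
  by rewrite card_gt0; apply/set0Pn; exists [tuple]; rewrite inE.
pose A := [set p : V * l.-tuple V | ok pre p.1 && chain (rcons pre p.1) p.2].
pose h (p : V * l.-tuple V) := [tuple of p.1 :: p.2].
have h_inj : injective h.
  by move=> [x s] [y t] /(congr1 val) /= [-> /val_inj ->].
have -> : [set t : l.+1.-tuple V | chain pre t] = h @: A.
  apply/setP=> t; rewrite inE; apply/idP/imsetP.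
    case/tupleP: t => x t /= ct; exists (x, t); rewrite ?inE //.
  by case=> -[x s]; rewrite inE /= => c ->.
rewrite card_imset // /A -sum1dep_card.
rewrite -(pair_big_dep (ok pre) (fun x (s : l.-tuple V) => chain (rcons pre x) s)
  (fun _ _ => 1)) /=.
apply: (@leq_trans (\sum_(x | ok pre x) a ^ l)).
  rewrite sum_nat_cond_const expnS leq_mul2r le_a ?orbT //; lia.
apply: leq_sum => x _; rewrite sum1dep_card; apply: IH => s.
by rewrite size_rcons => lt_s; apply: le_a; lia.
Qed.

End Counting.

(** * Windows and exchange moves *)

Section Absorption.
Variables (P V : finType) (nb : rel P) (r : P -> P -> rel V).
Hypothesis r_sym : forall x y u v, r x y u v = r y x v u.
Hypothesis r_free : forall x y u v, ~~ nb x y -> r x y u v.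
Hypothesis nb_sym : symmetric nb.
Variable L : nat.
Hypothesis nb_deg : forall x, #|[set y | nb x y]| <= L.

(** Fixing the number of constraints at [L], with padding when there are fewer, makes the demands a
    finite type over which weights can be summed. *)
Definition demand : finType := (L.-tuple (P * P * V) * V)%type.

(* The vertex at the slot [w 0] can move to a position with constraints [d.1],
   and [d.2] can take its place. *)
Definition accommodates (f : P -> V) (w : nat -> P) (d : demand) : bool :=
  all (fun c => r c.1.1 c.1.2 c.2 (f (w 0))) d.1 &&
  [forall i : 'I_L, r (w i.+1) (w 0) (f (w i.+1)) d.2].

Lemma eq_accommodates f g w d :
  (forall i, i <= L -> f (w i) = g (w i)) -> accommodates f w d = accommodates g w d.
Proof.
move=> fg; rewrite /accommodates fg //; congr (_ && _).
by apply: eq_forallb => i; rewrite fg.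
Qed.

Lemma embeds_absorb (T : nat) (wq : nat -> nat -> P) (f : P -> V) (D : {set P}) (J : {set 'I_T}) :
    #|P| = #|V| -> embeds r f D ->
    (forall j i, j < T -> i <= L -> wq j i \in D) ->
    (forall j y, j < T -> nb (wq j 0) y -> exists2 i, i < L & y = wq j i.+1) ->
    (forall j j' i, j < T -> j' < T -> j != j' -> i <= L -> wq j i != wq j' 0) ->
    (forall d, #|~: D| <= #|[set j in J | accommodates f (wq (j : 'I_T)) d]|) ->
  exists g, embeds r g setT.
Proof.
move=> PV; move: {2}#|~: D| (erefl #|~: D|) => m.
elim: m f D J => [|m IH] f D J cardD fD wD w_nb w_dis acc.
  exists f; move/eqP: cardD; rewrite cards_eq0 => /eqP D0.
  by rewrite -(setCK D) D0 setC0 in fD.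
have [x xD] : exists x, x \in ~: D by apply/set0Pn; rewrite -card_gt0 cardD.
rewrite inE in xD.
have [v] : exists v, v \in ~: f @: D.
  apply/set0Pn; rewrite -card_gt0; have := cardsC (f @: D); have := cardsC D.
  by rewrite (embeds_card fD); lia.
rewrite inE => vD.
have [cs le_cs csP] := nb_constraints r nb_sym nb_deg f D x.
pose cs' := cs ++ nseq (L - size cs) (x, x, v).
have sz_cs' : size cs' == L by rewrite size_cat size_nseq subnKC.
have := acc (Tuple sz_cs', v).
rewrite cardD => /(leq_ltn_trans (leq0n m)) /card_gt0P[j].
rewrite inE => /andP[jJ] /andP[/= + /forallP wv].
rewrite all_cat => /andP[/csP ux _].
set mid := wq j 0 in ux *; set u := f mid in ux *.
have jT := ltn_ord j.
have midD : mid \in D by apply: wD.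
have xmid : x != mid by apply: contraNneq xD => ->.
(* All [nb] neighbours of the slot lie in its window, hence in [D], so the new vertices at the slot
   and at [x] do not constrain each other. *)
have nb_midx : ~~ nb mid x.
  by apply: contra xD => /(w_nb _ _ jT) [i iL ->]; apply: wD.
have fD' : embeds r f (D :\ mid).
  by move=> y z; rewrite !inE => /andP[_ yD] /andP[_ zD]; apply: fD.
have emb1 : embeds r (upd f mid v) D.
  rewrite -(setD1K midD); apply: (embeds_setU1 r_sym r_free fD').
  - by rewrite !inE eqxx.
  - by apply: contra vD => /imsetP[y]; rewrite !inE => /andP[_ yD] ->; apply: imset_f.
  - move=> y _; rewrite nb_sym => /(w_nb _ _ jT) [i iL ->].
    by have := wv (Ordinal iL).
have emb2 : embeds r (upd (upd f mid v) x u) (x |: D).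
  apply: (embeds_setU1 r_sym r_free emb1) => //.
    apply/imsetP=> -[y yD]; rewrite /upd; case: eqP => [_ uv|ym uy].
      by case/negP: vD; rewrite -uv /u imset_f.
    by apply: ym; apply: (embeds_inj fD) => //; rewrite -uy.
  move=> y yD nbyx; rewrite /upd; case: eqP => [ym|_]; last exact: ux.
  by case/negP: nb_midx; rewrite -ym.
apply: (IH _ _ (J :\ j) _ emb2) => //.
- have := cardD; rewrite (cardsD1 x) inE xD => -[<-].
  by apply: eq_card => y; rewrite !inE negb_or.
- by move=> j' i j'T iL; rewrite inE wD ?orbT.
move=> d; have : #|~: (x |: D)| <= m.
  rewrite -ltnS -cardD (cardsD1 x (~: D)) inE xD ltnS; apply/subset_leq_card/subsetP=> y.
  by rewrite !inE negb_or.
move/leq_trans; apply; rewrite -ltnS -cardD; apply: leq_trans (acc d) _.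
rewrite (cardsD1 j); apply: (leq_add (leq_b1 _)); apply/subset_leq_card/subsetP=> j'.
rewrite !inE => /andP[jj' /andP[j'J]]; rewrite jj' j'J.
(* The exchange alters only [x], outside [D], and the slot of [j], which lies in no other window. *)
rewrite (eq_accommodates (g := upd (upd f mid v) x u)) // => i iL.
rewrite /upd ifN; last by apply: contraNneq xD => <-; apply: wD.
by rewrite ifN //; apply: w_dis.
Qed.


Variable d0 : nat.
Hypothesis r_deg : forall x y u, #|[set v | ~~ r x y u v]| <= d0.

(* Admissible next vertex of a window, its slot coming first: the slot has to
   serve the constraints of [d], its neighbours have to accept [d.2] in the slot. *)
Definition window_ok (w : nat -> P) (F : {set V}) (d : demand) (s : seq V) (x : V) : bool :=
  [&& x \notin F,
      [forall i : 'I_(size s), (nth d.2 s i != x) &&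
         r (w i) (w (size s)) (nth d.2 s i) x] &
      if size s == 0 then all (fun c => r c.1.1 c.1.2 c.2 x) d.1
      else r (w (size s)) (w 0) x d.2].

(** Every choice faces at most [L] constraints: the slot has those of [d.1], and any other window
    position has one from [d.2] in the slot and fewer than [L] from earlier window vertices. *)
Lemma card_window_ok (w : nat -> P) (F : {set V}) (d : demand) (s : seq V) (a : nat) :
    size s <= L ->
    (forall i, 0 < i <= L -> #|[set l : 'I_i | nb (w l) (w i)]| < L) ->
    a + L * d0 + #|F| + L <= #|V| ->
  a <= #|[set x | window_ok w F d s x]|.
Proof.
move=> sL wL le_a.
pose B := [set i : 'I_(size s) | nb (w i) (w (size s))].
pose tr (i : 'I_(size s)) := (w i, w (size s), nth d.2 s i).
pose cs := if size s == 0 then tval d.1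
  else (w 0, w (size s), d.2) :: [seq tr i | i <- enum B].
pose F' := F :|: [set x in s].
have sz_cs : size cs <= L.
  rewrite /cs; case: eqP => [_|/eqP s0]; first by rewrite size_tuple.
  by rewrite /= size_map -cardE; apply: wL; rewrite lt0n s0.
have sz_F' : #|F'| <= #|F| + L.
  apply: leq_trans (leq_card_setU _ _) _; rewrite leq_add2l cardsE.
  exact: leq_trans (card_size _) sL.
have le_A : a <= #|[set u | (u \notin F') && all (fun c => r c.1.1 c.1.2 c.2 u) cs]|.
  have lin x y f f' v A : a + x + f + L <= v -> f' <= f + L -> y <= x ->
      v <= A + (y + f') -> a <= A by lia.
  exact: lin le_a sz_F' (leq_mul sz_cs (leqnn d0)) (card_avail r_deg cs F').
apply: (leq_trans le_A); apply: subset_leq_card.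
apply/subsetP=> x; rewrite !inE negb_or /window_ok => /andP[/andP[-> xs] csx] /=.
apply/andP; split.
  apply/forallP=> i; apply/andP; split.
    by apply: contraNneq xs => <-; rewrite mem_nth.
  case: (boolP (nb (w i) (w (size s)))) => [nbi|/r_free]; last exact.
  have : tr i \in cs.
    rewrite /cs; case: eqP => [s0|_]; first by have := ltn_ord i; rewrite {2}s0.
    by rewrite inE map_f ?orbT // mem_enum inE.
  by move/(allP csx).
move: csx; rewrite /cs; case: eqP => // _ /= /andP[+ _].
by rewrite r_sym.
Qed.

Local Open Scope ring_scope.

(** The weight of a demand halves with each window serving it. Each demand is served by at least
    [a ^ L.+1] of the [#|V| ^ L.+1] tuples, so some tuple serves demands carrying at least a
    fraction [1 / C] of the total weight; halving these gives the factor [1 - 1 / (2 * C)]. *)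
Lemma embeds_windows (R : realType) (w : nat -> nat -> P) (T a C : nat) :
    (0 < #|P|)%N -> (0 < #|V|)%N -> (0 < C)%N ->
    (forall j i i', (j < T)%N -> (i < i' <= L)%N -> w j i != w j i') ->
    (forall j j' i i', (j' < j < T)%N -> (i <= L)%N -> (i' <= L)%N ->
       w j' i' != w j i /\ ~~ nb (w j' i') (w j i)) ->
    (forall j i, (j < T)%N -> (0 < i <= L)%N ->
       #|[set l : 'I_i | nb (w j l) (w j i)]| < L)%N ->
    (a + L * d0 + T * L.+1 + L <= #|V|)%N ->
    (#|V| ^ L.+1 <= C * a ^ L.+1)%N ->
  exists2 f, embeds r f (block_set w L.+1 T) &
    \sum_(d : demand) (2^-1 : R) ^+ #|[set j : 'I_T | accommodates f (w j) d]|
      <= #|demand|%:R * (1 - (2 * C%:R)^-1) ^+ T.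
Proof.
move=> P0 V0 C0 wI wD wL le_a leC.
have [v0 _] : exists v : V, v \in V by apply/card_gt0P.
have [p0 _] : exists p : P, p \in P by apply/card_gt0P.
suff: forall j, (j <= T)%N -> exists2 f, embeds r f (block_set w L.+1 j) &
    \sum_(d : demand) (2^-1 : R) ^+ #|[set i : 'I_j | accommodates f (w i) d]|
      <= #|demand|%:R * (1 - (2 * C%:R)^-1) ^+ j by exact.
have C0' : 0 < C%:R :> R by rewrite ltr0n.
have C1 : 1 <= C%:R :> R by rewrite ler1n.
elim=> [_|j IH jT].
  exists (fun=> v0).
    by move=> x y; rewrite /block_set big_ord0 inE.
  rewrite expr0 mulr1 -sum1_card natr_sum; apply: ler_sum => d _.
  rewrite (_ : [set i : 'I_0 | _] = set0) ?cards0 ?expr0 //.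
  by apply/setP=> -[].
have [f fE sum_f] := IH (ltnW jT).
set D := block_set w L.+1 j in fE *.
pose F := f @: D.
have cardF : (#|F| <= j * L.+1)%N.
  rewrite /F (embeds_card fE) /D /block_set.
  elim: (j) => [|m IHm]; first by rewrite big_ord0 cards0.
  rewrite big_ord_recr /= mulSn addnC; apply: leq_trans (leq_card_setU _ _) _.
  by rewrite leq_add // -[X in (_ <= X)%N]card_ord leq_imset_card.
pose W (d : demand) : R := 2^-1 ^+ #|[set i : 'I_j | accommodates f (w i) d]|.
have W_gt0 d : 0 < W d by rewrite exprn_gt0 // invr_gt0 ltr0n.
pose gd d (t : L.+1.-tuple V) := chain (window_ok (w j) F d) [::] t.
have jL : (j * L.+1 + L.+1 <= T * L.+1)%N by rewrite addnC -mulSn leq_mul2r jT orbT.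
have card_gd d : (a ^ L.+1 <= #|[set t | gd d t]|)%N.
  apply: card_chain => s; rewrite add0n ltnS => sL; apply: card_window_ok => //.
    by move=> i; apply: wL.
  by lia.
pose SW := \sum_d W d.
have [||t _ t_le0] := @sum_le0_exists R _ setT
  (fun t : L.+1.-tuple V => SW - C%:R * \sum_(d | gd d t) W d).
- by rewrite cardsT card_tuple expn_gt0 V0.
- rewrite sumrB -mulr_sumr sumr_const cardsT card_tuple subr_le0.
  rewrite -[SW *+ _]mulr_natr (exchange_big_dep predT) //= /SW mulr_suml mulr_sumr.
  apply: ler_sum => d _; rewrite sumr_const -[_ *+ #|_|]mulr_natr mulrCA ler_pM2l //.
  rewrite -natrM ler_nat; apply: leq_trans leC _; rewrite leq_mul2l.
  apply/orP; right; apply: leq_trans (card_gd d) _; apply: subset_leq_card.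
  by apply/subsetP=> t; rewrite !inE => gdt; rewrite unfold_in inE gdt.
have gd_nth d i : gd d t -> (i <= L)%N ->
    window_ok (w j) F d (take i t) (nth v0 t i).
  by move=> gdt iL; have := chain_nth v0 gdt; apply; rewrite size_tuple.
have sz_take i : (i <= L)%N -> size (take i t) = i.
  by move=> iL; rewrite size_takel // size_tuple ltnW.
(* The total weight is positive, so [t] serves some demand; that one demand already ensures that [t]
   is a valid window avoiding [F]. *)
have [d1 gd1] : exists d, gd d t.
  have [d gdt|no] := pickP [pred d | gd d t]; first by exists d.
  move: t_le0; rewrite big_pred0 // mulr0 subr0 leNgt => /negP[].
  pose d1 : demand := ([tuple of nseq L (p0, p0, v0)], v0).
  by rewrite /SW (bigD1 d1) //= ltr_wpDr ?W_gt0 // sumr_ge0 // => d _; apply: ltW.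
have DS : block_set w L.+1 j.+1 = D :|: [set w j i | i : 'I_L.+1].
  by rewrite /block_set big_ord_recr.
have [|i iL||i i' /andP[ii' i'L]|f' [f'f f'w emb']] :=
    @embeds_block _ _ nb r r_sym r_free f D (w j) (fun i => nth v0 t i) L.+1 fE.
- by move=> i i' ii'; apply: wI.
- split.
    apply/block_setP=> -[j' [i' [j'j i'L /eqP]]]; apply/negP; rewrite eq_sym.
    by case: (wD j j' i i') => //; rewrite j'j.
  move=> _ /block_setP[j' [i' [j'j i'L ->]]].
  by case: (wD j j' i i') => //; rewrite j'j.
- by move=> i iL; have /and3P[] := gd_nth _ i gd1 iL.
- have /and3P[_ /forallP + _] := gd_nth _ i' gd1 i'L.
  rewrite sz_take // => /(_ (Ordinal ii')) /=.
  by rewrite (set_nth_default v0) ?sz_take // nth_take.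
exists f'; first by rewrite DS.
have acc' d : gd d t -> accommodates f' (w j) d.
  move=> gdt; apply/andP; split.
    by rewrite f'w //; have /and3P[_ _] := gd_nth _ 0%N gdt isT; rewrite take0.
  apply/forallP=> i; rewrite f'w ?ltnS //.
  have /and3P[_ _] := gd_nth _ i.+1 gdt (ltn_ord i).
  by rewrite sz_take.
have accD d i : (i < j)%N -> accommodates f' (w i) d = accommodates f (w i) d.
  move=> ij; apply: eq_accommodates => l lL; apply: f'f.
  by apply/block_setP; exists i, l.
have card_sum (m : nat) (p : pred nat) : #|[set i : 'I_m | p i]| = (\sum_(i < m) p i)%N.
  by rewrite -sum1dep_card big_mkcond; apply: eq_bigr => i _; case: (p i).
have term d : 2^-1 ^+ #|[set i : 'I_j.+1 | accommodates f' (w i) d]| <=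
    W d - (if gd d t then W d else 0) / 2 :> R.
  rewrite (card_sum _ (fun i => accommodates f' (w i) d)) big_ord_recr /=.
  rewrite (eq_bigr (fun i : 'I_j => nat_of_bool (accommodates f (w i) d))); last first.
    by move=> i _; rewrite accD.
  rewrite -(card_sum _ (fun i => accommodates f (w i) d)) exprD -/(W d).
  case: ifP => [/acc' ->|_]; first by have := W_gt0 d; lra.
  rewrite mul0r subr0 ler_piMr //; first exact: ltW.
  by rewrite exprn_ile1 ?invr_ge0 ?ler0n // invf_le1 ?ltr0n // ler1n.
apply: le_trans (ler_sum _ (fun d _ => term d)) _.
rewrite sumrB -mulr_suml -big_mkcond /=.
set G := \sum_(d | gd d t) W d in t_le0 *.
have SWC : SW / C%:R <= G by rewrite ler_pdivrMr // mulrC; lra.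
apply: (@le_trans _ _ (SW * (1 - (2 * C%:R)^-1))).
  by rewrite invfM mulrBr mulr1 lerD2l lerN2 mulrA mulrAC; lra.
rewrite exprSr mulrA ler_wpM2r // subr_ge0 invf_le1; lra.
Qed.

End Absorption.

(** * Powers of cycles *)

(** For [k < n] and [x, y < n] this says that the distance on the cycle is between 1 and [k].
    Subtraction is truncated, and the last two cases are the pairs across the point where the
    numbering wraps around. *)
Definition near (n k x y : nat) : bool :=
  [|| 0 < x - y <= k, 0 < y - x <= k, n <= x - y + k | n <= y - x + k].

Lemma near_sym n k : symmetric (near n k).
Proof. by move=> x y; rewrite /near; lia. Qed.

Lemma card_ord_le (n : nat) (A : {set 'I_n}) (s : seq nat) :
  (forall x, x \in A -> nat_of_ord x \in s) -> #|A| <= size s.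
Proof.
move=> As; rewrite cardE -(size_map (@nat_of_ord n)); apply: uniq_leq_size.
  by rewrite map_inj_uniq ?enum_uniq //; apply: val_inj.
by move=> _ /mapP[x + ->]; rewrite mem_enum; apply: As.
Qed.

Lemma card_near (n k : nat) (x : 'I_n) : k < n -> #|[set y : 'I_n | near n k x y]| <= 2 * k.
Proof.
move=> kn; pose s := [seq (x + i) %% n | i <- iota 1 k] ++
                     [seq (x + n - i) %% n | i <- iota 1 k].
have -> : 2 * k = size s by rewrite size_cat !size_map size_iota mul2n addnn.
have ltx := ltn_ord x.
apply: card_ord_le => y; rewrite inE mem_cat => xy; have lty := ltn_ord y.
apply/orP; case: (ltnP x y) => lt_xy.
  case: (leqP (y - x) k) => [yx|yx].
    by left; apply/mapP; exists (y - x); [rewrite mem_iota|rewrite modn_small]; lia.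
  right; apply/mapP; exists (n - (y - x)); first by rewrite mem_iota; move: xy; rewrite /near; lia.
  by rewrite (_ : x + n - (n - (y - x)) = y) ?modn_small //; lia.
case: (leqP (x - y) k) => [yx|yx].
  right; apply/mapP; exists (x - y); first by rewrite mem_iota; move: xy; rewrite /near; lia.
  by rewrite (_ : x + n - (x - y) = y + n) ?modnDr ?modn_small //; lia.
left; apply/mapP; exists (n - (x - y)); first by rewrite mem_iota; move: xy; rewrite /near; lia.
by rewrite (_ : x + (n - (x - y)) = y + n) ?modnDr ?modn_small //; lia.
Qed.

(** [a] and [b] count the forward and the backward steps of the walk. *)
Lemma cycle_walk (n : nat) (x : 'I_n) (p : seq 'I_n) :
  path (cycle_graph n) x p -> exists a b, a + b = size p /\ x + a = last x p + b %[mod n].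
Proof.
elim: p x => [|y p IH] x /=; first by move=> _; exists 0, 0.
case/andP=> /andP[_ xy] /IH[a [b [ab eqn]]].
case/orP: xy => /eqP e.
  exists a.+1, b; split; first by lia.
  by rewrite -eqn e /= modnDml addSnnS.
exists a, b.+1; split; first by lia.
rewrite addnS -[(last y p + b).+1]addn1 -(modnDml (last y p + b) 1) -eqn.
by rewrite modnDml addn1 e /= modnDml addSn.
Qed.

(** An edge of the power gives a walk of length at most [k]; cancelling forward against backward
    steps leaves a shift by at most [k] in one direction. *)
Lemma power_cycle_near (n k : nat) (x y : 'I_n) :
  k < n -> 0 < k -> power_graph (cycle_graph n) k x y -> near n k x y.
Proof.
move=> kn k0 /= xy.
have neq : x != y by apply: contraTneq xy => ->; rewrite power_adj_irr.
have {xy} [a [b [ab eqn]]] : exists a b, a + b <= k /\ x + a = y + b %[mod n].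
  case/orP: xy => [xy|/andP[_ dk]].
    have [|a [b [ab e]]] := @cycle_walk n x [:: y]; first by apply/andP.
    by exists a, b; rewrite ab.
  (* Being at most [k < n], the distance is not the default value of [dist], so a walk of that
     length exists. *)
  have dn : dist (cycle_graph n) x y < #|'I_n|.
    by rewrite [X in _ < X]card_ord (leq_ltn_trans dk kn).
  have : has (has_walk (cycle_graph n) x y) (iota 0 #|'I_n|).
    by rewrite has_find size_iota.
  move=> hasw; have := nth_find 0 hasw; rewrite -/(dist _ x y) nth_iota // add0n.
  case/existsP=> p /andP[pth /eqP lst]; have [a [b [ab e]]] := cycle_walk pth.
  by exists a, b; rewrite ab size_tuple -{2}lst.
have ltx := ltn_ord x; have lty := ltn_ord y.
have key (u v c : nat) : u < n -> v < n -> u != v -> c <= k -> u + c = v %[mod n] -> near n k u v.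
  move=> un vn uv ck; rewrite [v %% n]modn_small //.
  case: (ltnP (u + c) n) => ucn; first by rewrite modn_small // /near; lia.
  have -> : u + c = (u + c - n) + n by lia.
  by rewrite modnDr modn_small /near; lia.
case: (leqP b a) => ba.
  apply: (key _ _ (a - b)) => //; first by lia.
  by apply/eqP; rewrite -(eqn_modDr b) -addnA subnK // eqn.
rewrite near_sym; apply: (key _ _ (b - a)) => //; [by rewrite eq_sym|by lia|].
by apply/eqP; rewrite -(eqn_modDr a) -addnA subnK ?eqn // ltnW.
Qed.

(** * Arranging windows and blocks on the cycle *)

Local Open Scope ring_scope.

(* Windows are the first [2k + 1] of [3k + 1] consecutive positions, listed with
   the central one first. *)
Definition window_shift (k i : nat) : nat :=
  (if i == 0 then k else if i <= k then i.-1 else i)%N.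

(* [T] windows, then [S] blocks of length [K] separated by gaps of length [k]; at most
   [G] positions are left over. *)
Lemma cyclic_embedding (R : realType) (V : finType) (n' k d a C T S K G : nat)
    (lam zeta : R) (r : 'I_n'.+1 -> 'I_n'.+1 -> rel V) :
  let n := n'.+1 in let L0 := ((3 * k + 1) * T)%N in
    (0 < k)%N -> (0 < C)%N -> #|V| = n ->
    (forall x y u v, r x y u v = r y x v u) ->
    (forall (x y : 'I_n) u v, ~~ near n k x y -> r x y u v) ->
    (forall x y u, #|[set v | ~~ r x y u v]| <= d)%N ->
    (a + 2 * k * d + T * (2 * k).+1 + 2 * k <= n)%N ->
    (n ^ (2 * k).+1 <= C * a ^ (2 * k).+1)%N ->
    (2 * k * d + L0 <= n)%N ->
    (L0 + S * (K + k) + 2 * k <= n)%N -> (n <= L0 + S * K + G)%N ->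
    n%:R ^+ (6 * k + 1) * (1 - (2 * C%:R)^-1) ^+ T < (2^-1 : R) ^+ G ->
    0 <= lam -> zeta <= 1 / 2 ->
    (forall b u, (b < S)%N -> (u + L0 + b * K = n)%N ->
       [/\ (2 * K < u)%N, lam * K%:R <= zeta * (u - K)%:R &
           forall X : nat, expR (lam * X%:R / u%:R) <=
             n%:R ^+ 3 * expR (lam * d%:R / (n - L0)%:R) * (1 + 2 * zeta ^+ 2) ^+ b ->
             (2 * (k * X + K) < u)%N]) ->
  exists g, embeds r g setT.
Proof.
move=> n L0 k0 C0 cardV r_sym r_free r_deg le_a leC le_L0 le_S le_G ltG lam0 zeta2 num.
have kn : (k < n)%N by lia.
pose nb := [rel x y : 'I_n | near n k x y].
have nb_sym : symmetric nb by move=> x y; rewrite /nb /= near_sym.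
have nb_deg x : (#|[set y | nb x y]| <= 2 * k)%N by apply: card_near.
have cardP : #|'I_n| = n by apply: card_ord.
pose pos p : 'I_n := inord p.
have posE p : (p < n)%N -> pos p = p :> nat by move=> pn; rewrite inordK.
pose w j i := pos ((3 * k + 1) * j + window_shift k i)%N.
have shift_le i : (i <= 2 * k)%N -> (window_shift k i <= 2 * k)%N.
  by rewrite /window_shift; do 2?case: ifP; lia.
have wlt j i : (j < T)%N -> (i <= 2 * k)%N ->
    ((3 * k + 1) * j + window_shift k i + k < L0)%N.
  move=> jT iL; have := shift_le i iL; have : (j.+1 <= T)%N by [].
  rewrite /L0 -(leq_pmul2l (_ : 0 < 3 * k + 1)%N); lia.
have wE j i : (j < T)%N -> (i <= 2 * k)%N ->
    w j i = ((3 * k + 1) * j + window_shift k i)%N :> nat.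
  by move=> jT iL; rewrite posE //; have := wlt j i jT iL; lia.
have jj_lt j j' : (j' < j)%N -> ((3 * k + 1) * j' + (3 * k + 1) <= (3 * k + 1) * j)%N.
  by move=> jj'; rewrite -mulnSr leq_mul2l jj' orbT.
have wI j i i' : (j < T)%N -> (i < i' <= 2 * k)%N -> w j i != w j i'.
  move=> jT ii'; rewrite -(inj_eq (@ord_inj n)) !wE ?eqn_add2l //; try lia.
  by rewrite /window_shift; do 4?case: ifP; lia.
have wD j j' i i' : (j' < j < T)%N -> (i <= 2 * k)%N -> (i' <= 2 * k)%N ->
    w j' i' != w j i /\ ~~ nb (w j' i') (w j i).
  move=> /andP[jj' jT] iL i'L; have j'T := ltn_trans jj' jT.
  have := wlt j i jT iL; have := wlt j' i' j'T i'L; have := jj_lt _ _ jj'.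
  have := shift_le i iL; have := shift_le i' i'L.
  rewrite -(inj_eq (@ord_inj n)) /nb /= /near !wE //.
  move: ((3 * k + 1) * j)%N ((3 * k + 1) * j')%N => A A'.
  by move: (window_shift k i) (window_shift k i') => s s'; lia.
(* Only the last index [2 * k] has [2 * k] predecessors; its shift [2 * k] is not near the shift 0
   of index 1. *)
have wL j i : (j < T)%N -> (0 < i <= 2 * k)%N ->
    (#|[set l : 'I_i | nb (w j l) (w j i)]| < 2 * k)%N.
  move=> jT /andP[i0]; rewrite leq_eqVlt => /orP[/eqP iE|iL]; last first.
    by apply: leq_ltn_trans (max_card _) _; rewrite card_ord.
  have one_i : (1 < i)%N by lia.
  apply: (@leq_trans #|'I_i|); last by rewrite card_ord iE.
  rewrite -cardsT; apply: proper_card; apply/properP; split; first exact: subsetT.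
  exists (Ordinal one_i); rewrite ?inE //= /near !wE //; try lia.
  have iL : (i <= 2 * k)%N by rewrite iE.
  have := wlt j i jT iL; rewrite /window_shift iE /=; move: ((3 * k + 1) * j)%N => A.
  by do 4?case: ifP; lia.
have V0 : (0 < #|V|)%N by rewrite cardV.
have P0 : (0 < #|'I_n|)%N by rewrite cardP.
have [f fE sum_f] : exists2 f, embeds r f (block_set w (2 * k).+1 T) &
    \sum_(dm : demand 'I_n V (2 * k)) (2^-1 : R) ^+ #|[set j : 'I_T | accommodates r f (w j) dm]|
      <= #|demand 'I_n V (2 * k)|%:R * (1 - (2 * C%:R)^-1) ^+ T.
  apply: (@embeds_windows _ _ nb r r_sym r_free (2 * k) d r_deg R w T a C) => //.
  - by rewrite cardV.
  - by rewrite cardV.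
have card_dem : #|demand 'I_n V (2 * k)| = (n ^ (6 * k + 1))%N.
  rewrite card_prod card_tuple !card_prod cardP cardV addn1 expnSr.
  rewrite (_ : 6 * k = 3 * (2 * k))%N ?expnM; last by lia.
  by rewrite -[(n ^ 3)%N]/(n * (n * n))%N mulnA.
(* A demand with fewer than [G] windows would alone weigh more than the bound on the sum over all
   [n ^ (6 * k + 1)] demands. *)
have acc_f (dm : demand 'I_n V (2 * k)) : (G <= #|[set j : 'I_T | accommodates r f (w j) dm]|)%N.
  rewrite leqNgt; apply/negP=> ltc.
  move: sum_f; rewrite leNgt card_dem natrX => /negP[]; apply: lt_le_trans ltG _.
  rewrite (bigD1 dm) //= ler_wpDr ?sumr_ge0 //.
    by move=> i _; rewrite exprn_ge0 // invr_ge0.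
  by rewrite ler_wiXn2l ?invr_ge0 ?ler0n // ?invf_le1 ?ltr0n ?ler1n // ltnW.
pose F0 := [set x : 'I_n | (x < L0)%N].
have L0n : (L0 <= n)%N by lia.
have cardF0 : #|F0| = L0.
  have -> : F0 = [set widen_ord L0n i | i : 'I_L0].
    apply/setP=> x; rewrite inE; apply/idP/imsetP => [xL|[i _ ->]]; last exact: (ltn_ord i).
    by exists (Ordinal xL) => //; apply: ord_inj.
  by rewrite card_imset ?card_ord // => i j /(congr1 val) /= /ord_inj.
have wF0 : block_set w (2 * k).+1 T :|: F0 = F0.
  apply/setUidPr/subsetP=> _ /block_setP[j [i [jT iL ->]]].
  by rewrite inE wE //; have := wlt j i jT iL; lia.
have [|f1 f1f f1E] := embeds_greedy r_sym r_free r_deg nb_sym nb_deg (F := F0) fE.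
  by rewrite wF0 cardF0 cardV.
rewrite wF0 in f1E.
(* A gap of [k] precedes every block and [2 * k] positions stay free at the end, so no two positions
   from different blocks, or from a block and [F0], are near. *)
pose bq b i := pos (L0 + k + b * (K + k) + i)%N.
have blt b i : (b < S)%N -> (i < K)%N -> (L0 + k + b * (K + k) + i + 2 * k < n)%N.
  move=> bS iK; have : (b.+1 * (K + k) <= S * (K + k))%N by rewrite leq_mul2r bS orbT.
  rewrite mulSn; lia.
have bE b i : (b < S)%N -> (i < K)%N -> bq b i = (L0 + k + b * (K + k) + i)%N :> nat.
  by move=> bS iK; rewrite posE //; have := blt b i bS iK; lia.
have [|||||f2 [f2f f2E cardD]] := @embeds_blocks R _ _ nb r r_sym r_free f1 F0 bq k K S
  lam zeta f1E _ _ _ _ lam0 zeta2.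
- move=> b i j bS ij; rewrite -(inj_eq (@ord_inj n)) !bE //; lia.
- move=> b i bS iK; have := blt b i bS iK; rewrite inE bE //; split; first by lia.
  by move=> y; rewrite inE /nb /= /near bE // => yL; lia.
- move=> b b' i i' /andP[b'b bS] iK i'K; have b'S := ltn_trans b'b bS.
  have := blt b i bS iK; have := blt b' i' b'S i'K.
  have : (b'.+1 * (K + k) <= b * (K + k))%N by rewrite leq_mul2r b'b orbT.
  rewrite mulSn -(inj_eq (@ord_inj n)) /nb /= /near !bE //.
  move: (b * (K + k))%N (b' * (K + k))%N => A A'; lia.
- move=> b i bS iK; rewrite -[X in (_ <= X)%N](size_iota (i - k)).
  apply: card_ord_le => j; rewrite inE /= /near !bE ?(ltn_trans (ltn_ord j)) //.
  have := blt b i bS iK; have := ltn_ord j; rewrite mem_iota; lia.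
- move=> b u bS; rewrite cardF0 cardV => u_eq; have [K_u lamK X_u] := num b u bS u_eq.
  split=> // X leX; apply: X_u; apply: le_trans leX _.
  apply: ler_wpM2r; first by rewrite exprn_ge0 // addr_ge0 // mulr_ge0 // sqr_ge0.
  rewrite /potential.
  have cardU : #|~: f1 @: F0| = (n - L0)%N.
    by have := cardsC (f1 @: F0); rewrite (embeds_card f1E) cardF0 cardV; lia.
  apply: (@le_trans _ _ (\sum_(c : 'I_n * 'I_n * V) expR (lam * d%:R / (n - L0)%:R))).
    apply: ler_sum => c _; rewrite cardU ler_expR ler_wpM2r ?invr_ge0 ?ler0n //.
    rewrite ler_wpM2l // ler_nat; apply: leq_trans (r_deg c.1.1 c.1.2 c.2).
    by apply/subset_leq_card/subsetP=> v; rewrite !inE => /andP[].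
  rewrite sumr_const !card_prod cardP cardV -[_ *+ _]mulr_natl !natrM.
  by rewrite (_ : 3 = 1 + 1 + 1)%N // !exprD expr1.
have wD2 j i : (j < T)%N -> (i <= 2 * k)%N -> w j i \in F0.
  by move=> jT iL; rewrite inE wE //; have := wlt j i jT iL; lia.
apply: (@embeds_absorb _ _ nb r r_sym r_free nb_sym (2 * k) nb_deg T w f2 _ setT _ f2E).
- by rewrite cardP cardV.
- by move=> j i jT iL; rewrite inE wD2.
- move=> j y jT; rewrite /nb /= /near wE // => nby.
  have := wlt j 0%N jT isT; have lty := ltn_ord y.
  set A := ((3 * k + 1) * j)%N in nby *; rewrite /window_shift /= in nby * => ltA.
  have [yk|yk] := ltnP (y - A) k.
    exists (y - A)%N; first by lia.
    apply: ord_inj; rewrite wE //; last by lia.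
    by rewrite /window_shift /= yk -/A; lia.
  exists (y - A).-1; first by lia.
  apply: ord_inj; rewrite wE //; last by lia.
  by rewrite /window_shift /= -/A; do 2?case: ifP; lia.
- move=> j j' i jT j'T jj' iL; case: (ltngtP j j') jj' => // lt_jj _.
    by case: (wD j' j 0%N i) => //; rewrite lt_jj.
  by rewrite eq_sym; case: (wD j j' i 0%N) => //; rewrite lt_jj.
move=> dm; apply: (@leq_trans G).
  have := cardsC (F0 :|: block_set bq K S); rewrite cardD cardF0 cardP; lia.
apply: leq_trans (acc_f dm) _; apply/subset_leq_card/subsetP=> j; rewrite !inE /=.
suff -> : accommodates r f (w j) dm = accommodates r f2 (w j) dm by [].
apply: eq_accommodates => i iL; rewrite f2f ?wD2 // f1f //; apply/block_setP.
by exists (j : nat), i.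
Qed.

(** * Choice of the parameters *)

(** With [e = c / p.+1], [expR (c * n)] is the power [p.+1] of [expR (e * n) >= e * n], and
    [(e * n) ^+ p.+1] exceeds [n ^+ p] once [n > e ^- p.+1]. *)
Lemma poly_lt_expR (R : realType) (c : R) (p : nat) :
  0 < c -> exists n1 : nat, forall n : nat, (n1 <= n)%N -> n%:R ^+ p < expR (c * n%:R).
Proof.
move=> c0; pose e : R := c / p.+1%:R.
have e0 : 0 < e by rewrite divr_gt0 ?ltr0n.
have ep0 : 0 < e ^+ p.+1 by rewrite exprn_gt0.
exists (Num.bound (e ^- p.+1)).+1 => n le_n.
have n0 : 0 < n%:R :> R by rewrite ltr0n; lia.
have -> : c * n%:R = p.+1%:R * (e * n%:R) by rewrite mulrA /e mulrCA divff ?mulr1 ?pnatr_eq0.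
rewrite expRM_natl; apply: (@lt_le_trans _ _ ((e * n%:R) ^+ p.+1)); last first.
  rewrite lerXn2r ?nnegrE ?expR_ge0 //; first by rewrite mulr_ge0 // ltW.
  by apply: (le_trans _ (expR_ge1Dx _)); rewrite lerDr.
rewrite exprMn [n%:R ^+ p.+1]exprS mulrA ltr_pMl ?exprn_gt0 //.
rewrite -ltr_pdivrMl // mulr1.
apply: (@lt_trans _ _ (Num.bound (e ^- p.+1))%:R); last by rewrite ltr_nat.
by apply: archi_boundP; rewrite invr_ge0 ltW.
Qed.

Lemma cyclic_pattern_embedding (R : realType) (k a : nat) :
    (0 < k)%N -> (0 < a)%N ->
  exists n0 : nat, forall n' (V : finType) (d h : nat) (r : 'I_n'.+1 -> 'I_n'.+1 -> rel V),
    let n := n'.+1 in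
    (n0 <= n)%N -> #|V| = n ->
    (forall x y u v, r x y u v = r y x v u) ->
    (forall (x y : 'I_n) u v, ~~ near n k x y -> r x y u v) ->
    (forall x y u, #|[set v | ~~ r x y u v]| <= d)%N ->
    (2 * k * d + h = n)%N -> (n <= a * h)%N ->
  exists g, embeds r g setT.
Proof.
move=> k0 a0.
(* The constants are opaque: the arithmetic tactics would otherwise unfold them. *)
have [C CE] : exists C, C = ((2 * a) ^ (2 * k).+1)%N by eexists.
have [c3 c3E] : exists c3, c3 = (3 * k + 1)%N by eexists.
(* With [G = n %/ M], this gives [4 * a * L0 = M * G <= n], hence [4 * L0 <= h]; the factor 8 in [K]
   below keeps the gaps between blocks within [G / 4]. *)
have [M ME] : exists M, M = (16 * C * c3 * a)%N by eexists.
have [K KE] : exists K, K = (8 * k * M)%N by eexists.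
(* [xi] is the tolerated growth of the non-neighbour ratio: [2 * k * xi = 1 / (4 * a)] is half of
   the margin [1 / (2 * a)] left by [d]. [kappa] is so small that second order terms use at most
   half of [xi]. *)
have [xi xiE] : exists xi : R, xi = (8 * k * a)%:R^-1 by eexists.
have [kappa kappaE] : exists kappa : R, kappa = xi / (4 * K * (6 * M) ^ 2)%:R by eexists.
have C0 : (0 < C)%N by rewrite CE expn_gt0 muln_gt0 a0.
have M0 : (0 < M)%N by rewrite ME c3E !muln_gt0 C0 a0 addn1.
have K0 : (0 < K)%N by rewrite KE muln_gt0 M0 muln_gt0 k0.
have xi0 : 0 < xi by rewrite xiE invr_gt0 ltr0n !muln_gt0 k0.
have kappa0 : 0 < kappa.
  by rewrite kappaE divr_gt0 // ltr0n muln_gt0 muln_gt0 K0 expn_gt0 muln_gt0 M0.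
have c1_gt0 : 0 < (2 * M)%:R^-1 :> R by rewrite invr_gt0 ltr0n muln_gt0 M0.
have c2_gt0 : 0 < kappa * xi / 2 by apply: divr_gt0; rewrite ?ltr0n //; apply: mulr_gt0.
have [n1 poly1] := poly_lt_expR (6 * k + 1) c1_gt0.
have [n2 poly2] := poly_lt_expR 3 c2_gt0.
have [G0 G0E] : exists G0, G0 = (32 * (a.+1 * (K + k)))%N by eexists.
exists (n1 + n2 + M * G0)%N => n' V d h r n le_n cardV r_sym r_free r_deg hn le_h.
have le1 : (n1 <= n)%N by lia.
have le2 : (n2 <= n)%N by lia.
have [G GE] : exists G, G = (n %/ M)%N by eexists.
have G_le : (M * G <= n)%N by rewrite GE mulnC leq_trunc_div.
have G_ge : (n < M * G + M)%N by rewrite GE -mulnSr mulnC ltn_ceil.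
have G0G : (G0 <= G)%N by rewrite GE leq_divRL // mulnC; move: le_n; lia.
have aKk : (K + k <= a.+1 * (K + k))%N by rewrite leq_pmull.
have aK : (a * K <= a.+1 * (K + k))%N by rewrite leq_mul // leq_addr.
have n2MG : (n <= 2 * (M * G))%N.
  have : (M <= M * G)%N by rewrite leq_pmulr //; lia.
  lia.
(* This many windows shrink the total weight by [expR (- (2 * G))]: one factor [expR (- G)]
   outweighs the polynomial number of demands, the other is at most [2^-1 ^+ G]. *)
have [T TE] : exists T, T = (4 * C * G)%N by eexists.
have [L0 L0E] : exists L0, L0 = (c3 * T)%N by eexists.
have L0h : (4 * L0 <= h)%N.
  rewrite -(leq_pmul2l a0); apply: leq_trans le_h; apply: leq_trans G_le.
  by apply: eq_leq; rewrite L0E TE ME; ring.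
have T0 : (0 < T)%N by rewrite TE muln_gt0 muln_gt0 C0 /=; move: G0G; rewrite G0E; lia.
have TL0 : (T * (2 * k).+1 + 2 * k <= 2 * L0)%N.
  have : (T * (2 * k).+1 <= L0)%N by rewrite L0E mulnC leq_mul2r c3E; apply/orP; right; lia.
  have : (c3 <= L0)%N by rewrite L0E leq_pmulr.
  rewrite c3E; lia.
have [A AE] : exists A, A = (h - (T * (2 * k).+1 + 2 * k))%N by eexists.
have [g gE] : exists g, g = G./2 by eexists.
have g2 : (2 * g <= G)%N by rewrite gE; lia.
have g3 : (G <= 3 * g)%N by rewrite gE; lia.
have g_ge : (16 * (a.+1 * (K + k)) <= g)%N by move: G0G; rewrite gE G0E; lia.
(* The blocks leave at least [g] vertices, so [u] stays linear in [n], yet at most [G] positions. *)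
have [S SE] : exists S, S = ((n - L0 - g) %/ (K + k))%N by eexists.
have Gn : (G <= n)%N by apply: leq_trans G_le; rewrite leq_pmull.
have S_le : (S * (K + k) <= n - L0 - g)%N by rewrite SE leq_trunc_div.
have S_gt : (n - L0 - g < S * (K + k) + (K + k))%N by rewrite SE -mulSnr ltn_ceil // addn_gt0 K0.
have SKn : (S * K <= n)%N.
  apply: (@leq_trans (S * (K + k))); first by rewrite leq_mul2l leq_addr orbT.
  by apply: leq_trans S_le _; rewrite -subnDA leq_subr.
have SkG : (4 * (S * k) <= G)%N.
  rewrite -(leq_pmul2l M0) -(leq_pmul2l (isT : 0 < 2)%N).
  apply: leq_trans n2MG; apply: leq_trans SKn.
  by apply: eq_leq; rewrite KE; ring.
have [zeta zetaE0] : exists zeta : R, zeta = xi / (4 * (6 * M)%:R) by eexists.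
have M6 : 1 <= (6 * M)%:R :> R by rewrite ler1n muln_gt0 M0.
have M1 : 1 <= M%:R :> R by rewrite ler1n.
have K1 : 1 <= K%:R :> R by rewrite ler1n.
have zetaE : zeta = kappa * K%:R * (6 * M)%:R.
  rewrite zetaE0 kappaE !natrM; field.
  by rewrite !gt_eqF ?ltr0n.
have xi1 : xi <= 1 by rewrite xiE invf_le1 ?ltr0n ?ler1n !muln_gt0 k0 a0.
apply: (@cyclic_embedding R V n' k d A C T S K G (kappa * n%:R) zeta) => //.
- by rewrite AE; move: hn L0h TL0; clear; lia.
(* [A] is at least half of [h], so [n <= 2 * a * A], whence the value of [C]. *)
- rewrite CE -expnMn leq_exp2r //; apply: leq_trans le_h _.
  by rewrite -mulnA mulnCA leq_mul2l; apply/orP; right; rewrite AE; move: L0h TL0; clear; lia.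
- by rewrite -c3E -L0E; move: hn L0h; clear; lia.
- by rewrite -c3E -L0E; move: hn S_le L0h g2 Gn g_ge aKk; clear; lia.
- by rewrite -c3E -L0E; move: hn L0h g2 Gn g_ge aKk S_gt SkG; rewrite mulnDr; clear; lia.
- have G_n : (2 * M)%:R^-1 * n%:R <= G%:R :> R.
    by rewrite ler_pdivrMl ?ltr0n ?muln_gt0 ?M0 // -natrM ler_nat -mulnA.
  have exp2 : expR (- G%:R) <= 2^-1 ^+ G :> R.
    rewrite -[G%:R]mulr1 -mulrN expRM_natl lerXn2r ?nnegrE ?expR_ge0 ?invr_ge0 //.
    rewrite expRN lef_pV2 ?posrE ?expR_gt0 //.
    by have := expR_ge1Dx (1 : R); lra.
  apply: lt_le_trans exp2.
  have C1 : 1 <= C%:R :> R by rewrite ler1n.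
  have expT : (1 - (2 * C%:R)^-1) ^+ T <= expR (- (2 * G%:R)) :> R.
    have -> : - (2 * G%:R) = T%:R * (- (2 * C%:R)^-1) :> R.
      by rewrite TE !natrM; field; rewrite gt_eqF ?ltr0n.
    rewrite expRM_natl lerXn2r ?nnegrE ?expR_ge0 //; last exact: expR_ge1Dx.
    by rewrite subr_ge0 invf_le1; lra.
  apply: (@lt_le_trans _ _ (expR G%:R * expR (- (2 * G%:R)))); last first.
    by rewrite -expRD ler_expR; lra.
  apply: (@le_lt_trans _ _ (n%:R ^+ (6 * k + 1) * expR (- (2 * G%:R)))).
    by rewrite ler_wpM2l // exprn_ge0.
  rewrite ltr_pM2r ?expR_gt0 //; apply: lt_le_trans (poly1 _ le1) _.
  by rewrite ler_expR.
- by rewrite mulr_ge0 ?ler0n // ltW.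
- by rewrite zetaE0 ler_pdivrMr; lra.
move=> b u bS; rewrite -c3E -L0E -/n => u_eq.
have ug : (g + K <= u)%N.
  have : (b.+1 * (K + k) <= S * (K + k))%N by rewrite leq_mul2r bS orbT.
  rewrite mulSn mulnDr; move: S_le u_eq hn L0h g2 Gn aKk g_ge; clear; lia.
have u0 : (0 < u)%N by move: ug K0; clear; lia.
have n6Mg : n%:R <= (6 * M)%:R * (u - K)%:R :> R.
  rewrite -natrM ler_nat; apply: leq_trans n2MG _.
  apply: (@leq_trans (2 * (M * (3 * (u - K))))); last by apply: eq_leq; ring.
  rewrite leq_mul2l leq_mul2l; apply/orP; right; apply/orP; right.
  by apply: leq_trans g3 _; rewrite leq_mul2l; move: ug; clear; lia.
split; first by move: ug g_ge aKk k0; clear; lia.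
- by rewrite zetaE -!mulrA ler_pM2l // mulrC ler_wpM2l ?ler0n.
move=> X leX.
have u0R : 0 < u%:R :> R by rewrite ltr0n.
have nL0 : 0 < (n - L0)%:R :> R by rewrite ltr0n; move: u_eq u0; clear; lia.
have n0R : 0 < n%:R :> R by rewrite ltr0n.
have zeta_b : 2 * zeta ^+ 2 * b%:R <= kappa * xi / 2 * n%:R.
  have -> : 2 * zeta ^+ 2 * b%:R = kappa * xi / 2 * (b * K)%:R.
    rewrite zetaE natrM; rewrite kappaE !natrM; field.
    by rewrite !gt_eqF ?ltr0n.
  rewrite ler_pM2l // ler_nat; apply: leq_trans SKn.
  by rewrite leq_mul2r ltnW ?orbT.
(* After taking logarithms, the factor [n ^ 3] and the growth factor each cost at most
   [kappa * xi / 2 * n], so the ratio rises by at most [xi]. *)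
have X_le : kappa * n%:R * X%:R / u%:R <=
    kappa * n%:R * (xi + d%:R / (n - L0)%:R).
  rewrite -ler_expR; apply: (le_trans leX).
  apply: (@le_trans _ _ (expR (kappa * xi / 2 * n%:R) *
     expR (kappa * n%:R * d%:R / (n - L0)%:R) * expR (2 * zeta ^+ 2 * b%:R))).
    apply: ler_pM; rewrite ?mulr_ge0 ?expR_ge0 ?exprn_ge0 ?ler0n //.
    - by rewrite addr_ge0 // mulr_ge0 // sqr_ge0.
    - by rewrite ler_wpM2r ?expR_ge0 // ltW // poly2.
    - rewrite [_ * b%:R]mulrC expRM_natl lerXn2r ?nnegrE ?expR_ge0 //; last exact: expR_ge1Dx.
      by rewrite addr_ge0 // mulr_ge0 // sqr_ge0.
  rewrite -!expRD ler_expR mulrDr !mulrA.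
  have := zeta_b; lra.
have {}X_le : X%:R / u%:R <= xi + d%:R / (n - L0)%:R.
  by move: X_le; rewrite -mulrA ler_pM2l // mulr_gt0.
have a1 : 1 <= a%:R :> R by rewrite ler1n.
have k1 : 1 <= k%:R :> R by rewrite ler1n.
have d_le : (2 * k * d)%:R / (n - L0)%:R <= 1 - (2 * a)%:R^-1 :> R.
  have le_nat : (2 * a * (2 * k * d) + (n - L0) <= 2 * a * (n - L0))%N.
    have := leq_mul (leqnn a) L0h; have : (a * (2 * k * d) + a * h = a * n)%N.
      by rewrite -mulnDr hn.
    rewrite mulnBr -!mulnA [(a * (4 * L0))%N]mulnCA; move: L0h le_h hn.
    by move: (a * (2 * (k * d)))%N (a * h)%N (a * n)%N (a * L0)%N; clear; lia.
  have a2 : 0 < (2 * a)%:R :> R by rewrite ltr0n muln_gt0.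
  rewrite ler_pdivrMr // -(ler_pM2l a2).
  have -> : (2 * a)%:R * ((1 - (2 * a)%:R^-1) * (n - L0)%:R) =
      (2 * a)%:R * (n - L0)%:R - (n - L0)%:R :> R.
    by rewrite mulrA mulrBr mulr1 divff ?gt_eqF // mulrBl mul1r.
  by rewrite lerBrDr -!natrM -natrD ler_nat.
(* Equivalently [2 * k * X <= (1 - 1 / (4 * a)) * u]; the remaining [u / (4 * a)] exceeds
   [2 * K]. *)
have uX : (8 * a * k * X + u <= 4 * a * u)%N.
  rewrite -(ler_nat R) natrD !natrM.
  have : 2 * k%:R * (X%:R / u%:R) <= 1 - (4 * a%:R)^-1 :> R.
    have -> : 1 - (4 * a%:R)^-1 = 2 * k%:R * xi + (1 - (2 * a)%:R^-1) :> R.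
      rewrite xiE !natrM; field; rewrite !gt_eqF ?ltr0n //.
    apply: le_trans (_ : _ <= 2 * k%:R * (xi + d%:R / (n - L0)%:R)) _.
      by rewrite ler_wpM2l // mulr_ge0 ?ler0n.
    by rewrite mulrDr lerD2l; move: d_le; rewrite !natrM !mulrA.
  rewrite mulrA ler_pdivrMr //.
  have -> : 8 * a%:R * k%:R * X%:R = 4 * a%:R * (2 * k%:R * X%:R) :> R by ring.
  move/(ler_wpM2l (_ : 0 <= 4 * a%:R)).
  have -> : 4 * a%:R * ((1 - (4 * a%:R)^-1) * u%:R) = 4 * a%:R * u%:R - u%:R :> R.
    by field; rewrite gt_eqF ?ltr0n.
  by rewrite lerBrDr; apply; rewrite mulr_ge0 ?ler0n.
have a4 : (0 < 4 * a)%N by rewrite muln_gt0 a0.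
rewrite -(ltn_pmul2l a4); apply: leq_trans uX.
have -> : (4 * a * (2 * (k * X + K)) = 8 * a * k * X + 8 * (a * K))%N by ring.
rewrite ltn_add2l; move: ug g_ge aK u0; clear; lia.
Qed.

(** * From coloured graphs to compatibility relations *)

Lemma mem_edge_set (T : finType) (G : sgraph T) (x y : T) :
  [set x; y] \in edge_set G -> G x y.
Proof.
case/imsetP=> -[u v]; rewrite inE /= => Guv eq_xy.
have neq_uv : u != v by apply: contraTneq Guv => ->; rewrite adj_irr.
have: u \in [set x; y] by rewrite eq_xy !inE eqxx.
have: v \in [set x; y] by rewrite eq_xy !inE eqxx orbT.
rewrite !inE => /orP[]/eqP vE /orP[]/eqP uE; move: Guv neq_uv; rewrite uE vE ?eqxx //.
by rewrite adj_sym.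
Qed.

Lemma bigminn_le (I : finType) (x : nat) (F : I -> nat) (i : I) :
  (\big[minn/x]_j F j <= F i)%N.
Proof.
have : i \in index_enum I by apply: mem_index_enum.
elim: (index_enum I) => // j s IH; rewrite inE big_cons => /orP[/eqP <-|/IH le_i].
  exact: geq_minl.
by rewrite geq_min le_i orbT.
Qed.

Lemma bigminn_le_id (I : finType) (x : nat) (F : I -> nat) :
  (\big[minn/x]_j F j <= x)%N.
Proof. by elim/big_rec: _ => // j y _ le_y; rewrite geq_min le_y orbT. Qed.

Lemma card_nonadj (V : finType) (m : nat) (G : 'I_m -> sgraph V) (c : 'I_m) (u : V) :
  (#|[set v | ~~ G c u v]| <= #|V| - min_degree_coll G)%N.
Proof.
have -> : [set v | ~~ G c u v] = ~: [set v | G c u v] by apply/setP=> v; rewrite !inE.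
rewrite -(cardsC [set v | G c u v]) -/(degree (G c) u).
have : (min_degree_coll G <= degree (G c) u)%N.
  by apply: leq_trans (bigminn_le _ _ c) (bigminn_le _ _ u).
lia.
Qed.

Theorem theorem1p2 (R : realType) (k : nat) (hk : (2 <= k)%N)
    (alpha : R) (halpha : 0 < alpha) :
  exists n0 : nat, forall n : nat, (n0 <= n)%N ->
    forall (V : finType), #|V| = n ->
    forall (m : nat) (G : 'I_m -> sgraph V),
      (1 - 1 / (2 * k%:R) + alpha) * n%:R <= (min_degree_coll G)%:R :> R ->
    forall chi : edge (power_graph (cycle_graph n) k) -> 'I_m,
      exists phi : 'I_n -> V, coloured_copy chi G phi.
Proof.
have k0 : (0 < k)%N by apply: ltnW.
(* A natural number with [a * alpha >= 1]: the slack [2 * k * alpha * n] is then at least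
   [n / a]. *)
pose a := (Num.bound alpha^-1).+1.
have a_alpha : 1 <= a%:R * alpha.
  rewrite -ler_pdivrMr // div1r; apply: le_trans (ltW (archi_boundP _)) _.
    by rewrite invr_ge0 ltW.
  by rewrite ler_nat.
have [n0 emb] := @cyclic_pattern_embedding R k a k0 isT.
exists (n0 + k.+1)%N => -[|n']; first by rewrite addnS.
set n := n'.+1 => le_n V cardV m G le_deg chi.
have kn : (k < n)%N by lia.
pose H := power_graph (cycle_graph n) k.
(* [insub] returns [None] when [[set x; y]] is not an edge, so [r] is trivially true there;
   unordered pairs make [r] symmetric. *)
pose e x y : option {e : {set 'I_n} | e \in edge_set H} := insub [set x; y].
pose r x y u v := if e x y is Some xy then G (chi xy) u v else true.
pose d := (n - min_degree_coll G)%N.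
have deg_n : (min_degree_coll G <= n)%N by rewrite -cardV bigminn_le_id.
have k0R : 0 < k%:R :> R by rewrite ltr0n.
have d_le : (2 * k%:R) * d%:R + (2 * k%:R) * alpha * n%:R <= n%:R :> R.
  have : 2 * k%:R * ((1 - 1 / (2 * k%:R) + alpha) * n%:R) <= 2 * k%:R * (n%:R - d%:R) :> R.
    rewrite ler_wpM2l ?mulr_ge0 ?ler0n //; by rewrite /d natrB // subKr.
  have -> : 2 * k%:R * ((1 - 1 / (2 * k%:R) + alpha) * n%:R) =
     2 * k%:R * n%:R - n%:R + 2 * k%:R * alpha * n%:R :> R by field; rewrite gt_eqF.
  by rewrite mulrBr; lra.
have n_ge0 : 0 <= n%:R :> R by rewrite ler0n.
have alpha_n : 0 <= (2 * k%:R) * alpha * n%:R by rewrite !mulr_ge0 // ltW.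
have d_n : (2 * k * d <= n)%N by rewrite -(ler_nat R) !natrM; lra.
have [||x y u v|x y u v|x y u|||phi phiE] := emb n' V d (n - 2 * k * d)%N r.
- by lia.
- exact: cardV.
- by rewrite /r /e setUC; case: insub => // xy; rewrite adj_sym.
- rewrite /r /e => nxy; rewrite insubN //; apply: contra nxy => /mem_edge_set.
  exact: power_cycle_near.
- rewrite /r; case: (e x y) => [xy|]; first by rewrite /d -cardV card_nonadj.
  by rewrite (_ : [set _ | _] = set0) ?cards0 //; apply/setP=> v; rewrite !inE.
- by rewrite subnKC.
- rewrite -(ler_nat R) natrM natrB // !natrM.
  apply: (@le_trans _ _ (a%:R * (2 * k%:R * alpha * n%:R))); last first.
    by rewrite ler_wpM2l ?ler0n //; lra.
  have k1 : 1 <= k%:R :> R by rewrite ler1n.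
  rewrite !mulrA ler_peMl // -mulrA mulrCA mulrAC; nra.
exists phi; split=> [x y|xy x y xyE]; first exact: (embeds_inj phiE).
have xyP : [set x; y] \in edge_set H by rewrite -xyE; apply: (valP xy).
have neq_xy : x != y by apply: contraTneq (mem_edge_set xyP) => ->; rewrite adj_irr.
have /andP[_] := phiE x y (in_setT _) (in_setT _) neq_xy.
by rewrite /r /e -xyE valK.
Qed.
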